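(* Let $n$ and $k$ be natural numbers with $k \geqslant 5$ and $n \geqslant 2(k-1)$, and let $G$ be one of $\mathrm{Aut}^{+}(F_n)$, $\mathrm{Out}^{+}(F_n)$, $\mathrm{SL}(n,\mathbb{Z})$. Then $G$ is generated by finitely many elements of order $k$ and $d_k(G) \leqslant 6$. If in addition $k \geqslant 6$ and $n \geqslant 2k$, then $d_k(G) \leqslant 5$.
   Context: $F_n$ is the free group of rank $n$. The abelianization $F_n \to F_n/[F_n,F_n]\cong \mathbb{Z}^n$ induces a homomorphism $\mathrm{Aut}(F_n)\to \mathrm{GL}(n,\mathbb{Z})$; $\mathrm{Aut}^{+}(F_n)$ is the preimage of $\mathrm{SL}(n,\mathbb{Z})$. Similarly, $\mathrm{Out}(F_n)=\mathrm{Aut}(F_n)/\mathrm{Inn}(F_n)$ maps to $\mathrm{GL}(n,\mathbb{Z})$, and $\mathrm{Out}^{+}(F_n)$ is the preimage of $\mathrm{SL}(n,\mathbb{Z})$. For a positive integer $k$ and a group $G$ generated by finitely many elements of order $k$, $d_k(G)$ denotes the smallest cardinality of a generating set of $G$ all of whose elements have order exactly $k$. *)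

(* Defs.v *)
From Stdlib Require List.
From HB Require Import structures.
From mathcomp Require Import all_boot all_order all_algebra.
Set Implicit Arguments. Unset Strict Implicit. Unset Printing Implicit Defensive.
Import GRing.Theory Num.Theory.

Record cgroup := CGroup {
  cg_T   : Type;
  cg_mem : cg_T -> Prop;
  cg_mul : cg_T -> cg_T -> cg_T;
  cg_one : cg_T;
  cg_eqv : cg_T -> cg_T -> Prop
}.
Arguments cg_mem : clear implicits.
Arguments cg_mul : clear implicits.
Arguments cg_one : clear implicits.
Arguments cg_eqv : clear implicits.

Definition cg_pow (G : cgroup) (x : cg_T G) (m : nat) : cg_T G :=
  iter m (cg_mul G x) (cg_one G).

Definition has_order (G : cgroup) (x : cg_T G) (k : nat) : Prop :=
  0 < k /\ cg_eqv G (cg_pow x k) (cg_one G) /\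
  forall j, 0 < j -> j < k -> ~ cg_eqv G (cg_pow x j) (cg_one G).

Definition generates (G : cgroup) (S : seq (cg_T G)) : Prop :=
  forall g, cg_mem G g ->
    exists ys : seq (cg_T G),
      (forall y, List.In y ys ->
         List.In y S \/ exists s, List.In s S /\ cg_mem G y /\
                                  cg_eqv G (cg_mul G s y) (cg_one G)) /\
      cg_eqv G g (foldr (cg_mul G) (cg_one G) ys).

Definition dk_le (G : cgroup) (k m : nat) : Prop :=
  exists S : seq (cg_T G),
    size S <= m /\
    (forall s, List.In s S -> cg_mem G s /\ has_order s k) /\
    @generates G S.

Definition letter (n : nat) := ('I_n * bool)%type.  (* (i,true)=x_i, (i,false)=x_i^-1 *)
Definition inv_letter n (a : letter n) : letter n := (a.1, ~~ a.2).
Definition cons_red n (a : letter n) (w : seq (letter n)) : seq (letter n) :=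
  match w with
  | b :: w' => if b == inv_letter a then w' else a :: w
  | [::] => [:: a]
  end.
Definition reduce n (w : seq (letter n)) : seq (letter n) := foldr (@cons_red n) [::] w.
Definition winv n (w : seq (letter n)) : seq (letter n) := rev (map (@inv_letter n) w).

(* endomorphisms of F_n, given by the images of the generators x_0..x_{n-1} *)
Definition endo n := {ffun 'I_n -> seq (letter n)}.
Definition endo_apply n (f : endo n) (w : seq (letter n)) : seq (letter n) :=
  flatten (map (fun a : letter n => if a.2 then f a.1 else winv (f a.1)) w).
Definition endo_comp n (f g : endo n) : endo n := [ffun i => endo_apply f (g i)].
Definition endo_id n : endo n := [ffun i => [:: (i, true)]].
Definition endo_eq n (f g : endo n) : Prop := forall i, reduce (f i) = reduce (g i).

Definition expsum n (j : 'I_n) (w : seq (letter n)) : int :=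
  (\sum_(a <- w) (if a.1 == j then (if a.2 then 1 else -1) else 0))%R.
Definition abmx n (f : endo n) : 'M[int]_n := \matrix_(i, j) expsum j (f i).

Definition is_autplus n (f : endo n) : Prop :=
  (exists g : endo n, endo_eq (endo_comp f g) (endo_id n) /\
                      endo_eq (endo_comp g f) (endo_id n)) /\
  (\det (abmx f))%R = 1%R.

Definition AutPlus (n : nat) : cgroup :=
  @CGroup (endo n) (@is_autplus n) (@endo_comp n) (endo_id n) (@endo_eq n).

(* Out^+(F_n): same representatives, equality modulo inner automorphisms *)
Definition out_eq n (f g : endo n) : Prop :=
  exists w : seq (letter n), forall i, reduce (f i) = reduce (w ++ g i ++ winv w).
Definition OutPlus (n : nat) : cgroup :=
  @CGroup (endo n) (@is_autplus n) (@endo_comp n) (endo_id n) (@out_eq n).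

Definition SLZ (n : nat) : cgroup :=
  @CGroup 'M[int]_n (fun A => (\det A)%R = 1%R) (@mulmx int n n n) (1%:M)%R (@eq _).

(* Main.v *)
(* A permutation of the free generators that is a product of disjoint k-cycles has
   order k; if it is odd, then k is even and inverting one generator that it fixes
   repairs the determinant.  Take three of these, A, B and C, whose k-cycles permute
   consecutive blocks, the blocks of one overlapping those of another in at least
   two points, together with the conjugates of A by the right transvection r_01 and
   by the left transvection l_01.  All five have order k already in GL(n,Z).

   If A maps 0 to 1 to 2 to 3 and so on, (r_01 A r_01^-1) A^-1 = r_01 r_12^-1, and
   conjugating by A and multiplying gives every r_{i,i+1} r_{j,j+1}^-1 (indices mod
   k).  As k >= 5 the factor r_34 commutes with r_01 and r_12, so [r_01, r_12], which
   is r_02, is generated; likewise r_03.  The steps 2 and 3 generate all of Z/k, hence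
   every r_ij inside the first block, and the overlaps propagate this to all i, j.
   The same computation works for left transvections.

   Transvections generate Aut^+(F_n) by Nielsen reduction: an automorphism that
   minimizes the total length of the images of the generators, and then the ranks of
   the halves of these words, has small cancellation, so it permutes the generators
   up to inversion.  They generate SL(n,Z) by the Euclidean algorithm on columns. *)
Require Import Defs.
From Stdlib Require List.
From HB Require Import structures.
From mathcomp Require Import all_boot all_order all_algebra.
From mathcomp Require Import zify ring.

Set Implicit Arguments. Unset Strict Implicit. Unset Printing Implicit Defensive.
Import GRing.Theory Num.Theory.
Local Open Scope group_scope.

(** * Free groups and their endomorphisms *)

Section FreeGroup.
Variable n : nat.
Implicit Types (a b : letter n) (u v w : seq (letter n)).

Lemma inv_letterK : involutive (@inv_letter n).
Proof. by case=> i s; rewrite /inv_letter /= negbK. Qed.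

Lemma inv_letter_neq a : inv_letter a != a.
Proof. by case: a => i [] /=; apply/eqP=> -[]. Qed.

Lemma letter_eq a b : a.1 = b.1 -> b != inv_letter a -> b = a.
Proof. by case: a b => i [] [j []] /= <-; rewrite /inv_letter /= ?eqxx. Qed.

Definition is_red w := sorted (fun a b => b != inv_letter a) w.

Lemma cons_red_red a w : is_red w -> is_red (cons_red a w).
Proof.
case: w => //= b w; case: eqP => [_|/eqP ne] h /=; last by rewrite ne.
exact: path_sorted h.
Qed.

Lemma reduce_red w : is_red (reduce w).
Proof. by elim: w => //= a w IH; apply: cons_red_red. Qed.

Lemma cons_red_path a w :
  path (fun a b => b != inv_letter a) a w -> cons_red a w = a :: w.
Proof. by case: w => //= b w /andP[/negbTE -> _]. Qed.

Lemma reduce_id w : is_red w -> reduce w = w.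
Proof.
elim: w => //= a w IH h.
by rewrite IH ?cons_red_path //; apply: path_sorted h.
Qed.

(** Van der Waerden's argument: each letter acts on the reduced words as a permutation, and
    associativity of the product follows. *)
Lemma cons_redK a w : is_red w -> cons_red a (cons_red (inv_letter a) w) = w.
Proof.
case: w => [|b w] /= h; first by rewrite eqxx.
rewrite inv_letterK; case: eqP => [e|ne] /=; last by rewrite eqxx.
by rewrite -e cons_red_path.
Qed.

Lemma reduce_cat u v : reduce (u ++ v) = foldr (@cons_red n) (reduce v) u.
Proof. by rewrite /reduce foldr_cat. Qed.

Lemma foldr_red w u : is_red w -> is_red (foldr (@cons_red n) w u).
Proof. by move=> h; elim: u => //= a u; apply: cons_red_red. Qed.

Lemma foldr_cons_red w a u : is_red w ->
  foldr (@cons_red n) w (cons_red a u) = cons_red a (foldr (@cons_red n) w u).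
Proof.
case: u => //= b u h; case: eqP => //= ->.
by rewrite cons_redK //; apply: foldr_red.
Qed.

Lemma foldr_reduce w u : is_red w ->
  foldr (@cons_red n) w (reduce u) = foldr (@cons_red n) w u.
Proof. by move=> h; elim: u => //= a u IH; rewrite foldr_cons_red ?IH. Qed.

Lemma reduce_catl u v : reduce (reduce u ++ v) = reduce (u ++ v).
Proof. by rewrite !reduce_cat foldr_reduce ?reduce_red. Qed.

Lemma reduce_catr u v : reduce (u ++ reduce v) = reduce (u ++ v).
Proof. by rewrite !reduce_cat reduce_id ?reduce_red. Qed.

Lemma winv_cat u v : winv (u ++ v) = winv v ++ winv u.
Proof. by rewrite /winv map_cat rev_cat. Qed.

Lemma winv_cons a u : winv (a :: u) = winv u ++ [:: inv_letter a].
Proof. by rewrite -cat1s winv_cat. Qed.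

Lemma winvK : involutive (@winv n).
Proof.
move=> u; rewrite /winv map_rev revK -map_comp -[RHS]map_id.
by apply: eq_map => a /=; rewrite inv_letterK.
Qed.

Lemma size_winv u : size (winv u) = size u.
Proof. by rewrite size_rev size_map. Qed.

Lemma winv_red u : is_red u -> is_red (winv u).
Proof.
rewrite /is_red /winv rev_sorted sorted_map; apply: sub_sorted => a b /=.
by apply: contra => /eqP ->; rewrite inv_letterK.
Qed.

Lemma reduce_Vcat u v : reduce (winv u ++ u ++ v) = reduce v.
Proof.
elim: u v => // a u IH v; rewrite winv_cons -catA !reduce_cat /=.
have := cons_redK (inv_letter a) (reduce_red (u ++ v)).
by rewrite inv_letterK reduce_cat => ->; rewrite -2!reduce_cat IH.
Qed.

(** Elements are reduced words, so equality in the group is equality of terms and rewriting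
    applies. *)
Record fgrp := Free { fw : seq (letter n); fwP : is_red fw }.
HB.instance Definition _ := [isSub for fw].
HB.instance Definition _ := [Choice of fgrp by <:].

Definition ofw w := Free (reduce_red w).
Definition fgrp_mul (x y : fgrp) := ofw (fw x ++ fw y).
Definition fgrp_inv (x : fgrp) := Free (winv_red (fwP x)).

Lemma ofw_eq u v : (ofw u = ofw v) <-> (reduce u = reduce v).
Proof. by split=> [[]|h] //; apply: val_inj. Qed.

Lemma fgrp_mulA : associative fgrp_mul.
Proof.
by move=> x y z; apply/ofw_eq; rewrite reduce_catr reduce_catl catA.
Qed.
Lemma fgrp_mul1 : left_id (ofw [::]) fgrp_mul.
Proof. by move=> x; apply: val_inj; rewrite /= reduce_id ?fwP. Qed.
Lemma fgrp_mulr1 : right_id (ofw [::]) fgrp_mul.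
Proof. by move=> x; apply: val_inj; rewrite /= cats0 reduce_id ?fwP. Qed.
Lemma fgrp_mulV : left_inverse (ofw [::]) fgrp_inv fgrp_mul.
Proof.
by move=> x; apply/ofw_eq; rewrite /= -{2}[fw x]cats0 reduce_Vcat.
Qed.
Lemma fgrp_mulrV : right_inverse (ofw [::]) fgrp_inv fgrp_mul.
Proof.
move=> x; apply/ofw_eq; rewrite /=.
by have := reduce_Vcat (winv (fw x)) [::]; rewrite cats0 winvK.
Qed.
HB.instance Definition _ :=
  isGroup.Build fgrp fgrp_mulA fgrp_mul1 fgrp_mulr1 fgrp_mulV fgrp_mulrV.

Lemma ofw_cat u v : ofw (u ++ v) = ofw u * ofw v.
Proof. by apply/ofw_eq; rewrite /= reduce_catl reduce_catr. Qed.

Lemma ofw_nil : ofw [::] = 1. Proof. by []. Qed.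

Lemma ofw_winv u : ofw (winv u) = (ofw u)^-1.
Proof.
apply/esym/mulg1_eq; rewrite -ofw_cat; apply/ofw_eq.
by have := reduce_Vcat (winv u) [::]; rewrite cats0 winvK.
Qed.

Lemma ofwK x : ofw (fw x) = x.
Proof. by apply: val_inj; rewrite /= reduce_id ?fwP. Qed.
Lemma fwM (x y : fgrp) : fw (x * y) = reduce (fw x ++ fw y). Proof. by []. Qed.
Lemma fwV (x : fgrp) : fw x^-1 = winv (fw x). Proof. by []. Qed.

Definition gl a : fgrp := ofw [:: a].
Lemma gl_inv a : gl (inv_letter a) = (gl a)^-1.
Proof. by rewrite -ofw_winv. Qed.
Lemma ofw_cons a w : ofw (a :: w) = gl a * ofw w.
Proof. by rewrite -ofw_cat. Qed.

Lemma gl_inj : injective gl.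
Proof. by move=> a b []. Qed.

Definition fend := {ffun 'I_n -> fgrp}.
Implicit Types f g h : fend.

(** Values are taken at signed letters throughout, so that left and right transvections share their
    proofs. *)
Definition ev f a := if a.2 then f a.1 else (f a.1)^-1.
Definition ext f (x : fgrp) := \prod_(a <- fw x) ev f a.

Lemma ev_inv f a : ev f (inv_letter a) = (ev f a)^-1.
Proof. by case: a => i [] //=; rewrite /ev /= invgK. Qed.

Lemma ext_ofw f w : ext f (ofw w) = \prod_(a <- w) ev f a.
Proof.
rewrite /ext /=; elim: w => [|a w IH] /=; first by rewrite !big_nil.
rewrite big_cons -IH; case: (reduce w) => [|b v] /=; rewrite ?big_cons //.
by case: eqP => [->|_]; rewrite ?big_cons // ev_inv mulgA mulgV mul1g.
Qed.

Lemma extM f x y : ext f (x * y) = ext f x * ext f y.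
Proof. by rewrite ext_ofw big_cat. Qed.
Lemma ext1 f : ext f 1 = 1.
Proof. by rewrite -ofw_nil ext_ofw big_nil. Qed.
Lemma extV f x : ext f x^-1 = (ext f x)^-1.
Proof. by apply/esym/mulg1_eq; rewrite -extM mulgV ext1. Qed.
Lemma ext_gl f a : ext f (gl a) = ev f a.
Proof. by rewrite ext_ofw big_seq1. Qed.

Definition fend_mul f g : fend := [ffun i => ext f (g i)].
Definition fend_one : fend := [ffun i => gl (i, true)].

Lemma ev_mul f g a : ev (fend_mul f g) a = ext f (ev g a).
Proof. by rewrite /ev ffunE; case: a.2; rewrite ?extV. Qed.
Lemma ev_one a : ev fend_one a = gl a.
Proof. by case: a => i []; rewrite /ev ffunE //= -gl_inv. Qed.
Lemma ext_mul f g x : ext (fend_mul f g) x = ext f (ext g x).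
Proof.
rewrite {1 3}/ext; elim: (fw x) => [|a w IH]; rewrite ?big_nil ?ext1 //.
by rewrite !big_cons IH extM ev_mul.
Qed.
Lemma ext_one x : ext fend_one x = x.
Proof.
rewrite -[RHS]ofwK /ext; elim: (fw x) => [|a w IH]; rewrite ?big_nil //.
by rewrite big_cons IH ev_one -ofw_cons.
Qed.

Lemma fend_mulA : associative fend_mul.
Proof. by move=> f g h; apply/ffunP=> i; rewrite [LHS]ffunE [RHS]ffunE ffunE ext_mul. Qed.
Lemma fend_mul1 : left_id fend_one fend_mul.
Proof. by move=> f; apply/ffunP=> i; rewrite ffunE ext_one. Qed.
Lemma fend_mulr1 : right_id fend_one fend_mul.
Proof. by move=> f; apply/ffunP=> i; rewrite !ffunE ext_gl. Qed.
HB.instance Definition _ := Choice.on fend.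
HB.instance Definition _ := isMonoid.Build fend fend_mulA fend_mul1 fend_mulr1.

Lemma evM f g a : ev (f * g) a = ext f (ev g a). Proof. exact: ev_mul. Qed.
Lemma ev1 a : ev 1 a = gl a. Proof. exact: ev_one. Qed.

Lemma fendP f g : (forall a, ev f a = ev g a) -> f = g.
Proof. by move=> h; apply/ffunP=> i; apply: (h (i, true)). Qed.

Lemma ev_index f g a c : c.1 = a.1 -> ev f a = ev g a -> ev f c = ev g c.
Proof.
move=> e ea; have [->|ne] := eqVneq c (inv_letter a); first by rewrite !ev_inv ea.
by rewrite (letter_eq (esym e) ne).
Qed.

Lemma fend_letterP f g a : ev f a = ev g a ->
  (forall c, c.1 != a.1 -> ev f c = ev g c) -> f = g.
Proof.
move=> ea ec; apply: fendP => c.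
by have [e|/ec //] := eqVneq c.1 a.1; apply: ev_index ea.
Qed.

Definition red (f : endo n) : fend := [ffun i => ofw (f i)].
Definition unred f : endo n := [ffun i => fw (f i)].

Lemma unredK f : red (unred f) = f.
Proof. by apply/ffunP=> i; rewrite !ffunE ofwK. Qed.

Lemma redP (f g : endo n) : endo_eq f g <-> red f = red g.
Proof.
split=> [h|h i]; first by apply/ffunP=> i; rewrite !ffunE; apply/ofw_eq.
by apply/ofw_eq; move/ffunP/(_ i): h; rewrite !ffunE.
Qed.

Lemma ofw_apply (f : endo n) w : ofw (endo_apply f w) = ext (red f) (ofw w).
Proof.
rewrite ext_ofw; elim: w => [|a w IH]; rewrite ?big_nil //.
rewrite /endo_apply /= ofw_cat big_cons [ofw (flatten _)]IH; congr (_ * _).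
by rewrite /ev ffunE; case: a.2; rewrite ?ofw_winv.
Qed.

Lemma redM (f g : endo n) : red (endo_comp f g) = red f * red g.
Proof. by apply/ffunP=> i; rewrite !ffunE ofw_apply. Qed.
Lemma red1 : red (endo_id n) = 1.
Proof. by apply/ffunP=> i; rewrite !ffunE. Qed.

Local Open Scope ring_scope.

Lemma expsum_cat j u v : expsum j (u ++ v) = expsum j u + expsum j v.
Proof. by rewrite /expsum big_cat. Qed.
Lemma expsum_cons j a u : expsum j (a :: u) =
  (if a.1 == j then (if a.2 then 1 else -1) else 0) + expsum j u.
Proof. by rewrite /expsum big_cons. Qed.
Lemma expsum_nil (j : 'I_n) : expsum j [::] = 0.
Proof. by rewrite /expsum big_nil. Qed.

Lemma expsum_reduce j w : expsum j (reduce w) = expsum j w.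
Proof.
elim: w => //= a w IH; rewrite expsum_cons -IH; case: (reduce w) => [|b v] /=.
  by rewrite expsum_cons.
case: eqP => [->|_]; rewrite !expsum_cons //=.
by case: (a.1 == j); case: a.2; rewrite /= ?addrA ?subrr ?addNr ?add0r.
Qed.

Lemma expsumM j (x y : fgrp) :
  expsum j (fw (x * y)%g) = expsum j (fw x) + expsum j (fw y).
Proof. by rewrite expsum_reduce expsum_cat. Qed.
Lemma expsum1 j : expsum j (fw 1%g) = 0.
Proof. exact: expsum_nil. Qed.
Lemma expsumV j (x : fgrp) : expsum j (fw x^-1%g) = - expsum j (fw x).
Proof. by apply/eqP; rewrite -addr_eq0 addrC -expsumM mulgV expsum1. Qed.

Lemma expsum_ext j f x :
  expsum j (fw (ext f x)) = \sum_i expsum i (fw x) * expsum j (fw (f i)).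
Proof.
rewrite /ext; elim: (fw x) => [|a w IH].
  by rewrite big_nil expsum1 big1 // => i _; rewrite expsum_nil mul0r.
rewrite big_cons expsumM IH.
under [RHS]eq_bigr do rewrite expsum_cons mulrDl.
rewrite big_split /=; congr (_ + _).
rewrite (bigD1 a.1) //= eqxx big1 ?addr0 => [|i ne]; last first.
  by rewrite eq_sym (negbTE ne) mul0r.
by rewrite /ev; case: a.2; rewrite ?mul1r // mulN1r expsumV.
Qed.

Definition abF f : 'M[int]_n := \matrix_(i, j) expsum j (fw (f i)).

Lemma abmx_red (f : endo n) : abmx f = abF (red f).
Proof. by apply/matrixP=> i j; rewrite !mxE ffunE expsum_reduce. Qed.

(** Row [i] holds the exponents of the image of [x_i]; under this row convention composition becomes
    the product in the opposite order. *)
Lemma abFM f g : abF (f * g)%g = abF g *m abF f.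
Proof.
apply/matrixP=> i j; rewrite !mxE ffunE expsum_ext.
by apply: eq_bigr => l _; rewrite !mxE.
Qed.

Lemma expsum_gl j a :
  expsum j (fw (gl a)) = if a.1 == j then (if a.2 then 1 else -1) else 0.
Proof. by rewrite /= expsum_cons expsum_nil addr0. Qed.

Lemma abF1 : abF 1%g = 1%:M.
Proof. by apply/matrixP=> i j; rewrite !mxE ffunE expsum_gl /=; case: eqP. Qed.

Definition autp f := (exists g, (f * g = 1 /\ g * f = 1)%g) /\ \det (abF f) = 1.

Lemma is_autplusP (f : endo n) : is_autplus f <-> autp (red f).
Proof.
rewrite /is_autplus /autp -abmx_red; split=> -[[g [e1 e2]] d]; split=> //.
  by exists (red g); split; rewrite -redM -red1; apply/redP.
by exists (unred g); split; apply/redP; rewrite redM unredK red1.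
Qed.

End FreeGroup.
Arguments autp {n} f.

(** * Transvections and their relations *)

Section Transvections.
Variable n : nat.
Implicit Types (a b c d : letter n) (f g : fend n) (i j : 'I_n) (s : bool).

(* [tr a b] sends the letter [a] to [a b]: [tr (i, true) (j, true)] is the right
   transvection [x_i -> x_i x_j], and [tr (i, false) (j, false)] the left one
   [x_i -> x_j x_i]. *)
Definition tr a b : fend n :=
  [ffun i => if i == a.1 then (if a.2 then gl a * gl b else (gl a * gl b)^-1)
             else gl (i, true)].

Lemma ev_tr a b : ev (tr a b) a = gl a * gl b.
Proof. by rewrite /ev ffunE eqxx; case: a.2; rewrite ?invgK. Qed.

Lemma ev_tr_id a b c : c.1 != a.1 -> ev (tr a b) c = gl c.
Proof.
by case: c => i [] ne; rewrite /ev ffunE /= (negbTE ne) //= -gl_inv.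
Qed.

Lemma evM_tr f a b : ev (f * tr a b) a = ev f a * ev f b.
Proof. by rewrite evM ev_tr extM !ext_gl. Qed.

Lemma evM_tr_id f a b c : c.1 != a.1 -> ev (f * tr a b) c = ev f c.
Proof. by move=> ne; rewrite evM ev_tr_id // ext_gl. Qed.

Lemma trK a b : a.1 != b.1 -> tr a b * tr a (inv_letter b) = 1.
Proof.
move=> ne; apply: (@fend_letterP _ _ _ a) => [|c nc].
  by rewrite evM_tr ev_tr ev_tr_id 1?eq_sym // gl_inv mulgK ev1.
by rewrite evM_tr_id ?ev_tr_id ?ev1.
Qed.

Lemma trVK a b : a.1 != b.1 -> tr a (inv_letter b) * tr a b = 1.
Proof. by move=> ne; rewrite -{2}[b]inv_letterK trK. Qed.

Lemma tr_comm a b c d : a.1 != c.1 -> a.1 != d.1 -> c.1 != b.1 ->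
  tr a b * tr c d = tr c d * tr a b.
Proof.
move=> ac ad cb; apply: (@fend_letterP _ _ _ a) => [|x xa].
  by rewrite evM_tr_id // evM_tr ev_tr !ev_tr_id // eq_sym.
have [xc|xc] := eqVneq x.1 c.1; last by rewrite !evM_tr_id ?ev_tr_id.
apply: (ev_index xc).
by rewrite evM_tr evM_tr_id 1?eq_sym // ev_tr !ev_tr_id // eq_sym.
Qed.

(** The Steinberg commutator relation. The signs of the three letters are arbitrary, so left, right
    and mixed transvections are all covered. *)
Lemma tr_comm3 a b c : a.1 != b.1 -> b.1 != c.1 -> a.1 != c.1 ->
  tr a (inv_letter b) * tr b c * tr a b * tr b (inv_letter c) = tr a c.
Proof.
move=> ab bc ac.
have [ba ca] : b.1 != a.1 /\ c.1 != a.1 by rewrite ![_ == a.1]eq_sym.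
have cb : c.1 != b.1 by rewrite eq_sym.
have eb : ev (tr a (inv_letter b) * tr b c * tr a b * tr b (inv_letter c)) b = gl b.
  rewrite evM_tr evM_tr_id // evM_tr ev_inv !evM_tr_id //.
  by rewrite !ev_tr_id // mulgK.
apply: (@fend_letterP _ _ _ a) => [|x xa].
  rewrite evM_tr_id // evM_tr evM_tr_id // (ev_tr a (inv_letter b)) evM_tr.
  by rewrite (ev_tr_id _ ba) ev_tr_id // (ev_tr a c) gl_inv mulgA mulgVK.
rewrite ev_tr_id //.
have [xb|xb] := eqVneq x.1 b.1; last by rewrite !evM_tr_id // ev_tr_id.
by rewrite (ev_index (g := 1) xb) ?ev1.
Qed.

(** Injectivity of [phi] on indices keeps the letters fixed by [tr a b] away from the index of
    [phi a]. *)
Lemma tr_conj f (phi : letter n -> letter n) a b :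
    (forall c, ev f c = gl (phi c)) ->
    (forall c d, (phi c).1 = (phi d).1 -> c.1 = d.1) ->
  f * tr a b = tr (phi a) (phi b) * f.
Proof.
move=> hf hi; apply: (@fend_letterP _ _ _ a) => [|c ca].
  by rewrite evM_tr evM !hf ext_gl ev_tr.
rewrite evM_tr_id // evM hf ext_gl ev_tr_id //.
by apply: contra ca => /eqP /hi ->.
Qed.

(** The quarter turn [x_i -> x_j], [x_j -> x_i^-1], a lift of the Weyl element of SL(2). *)
Definition wt i j : fend n :=
  tr (i, true) (j, true) * tr (j, true) (i, false) * tr (i, false) (j, false).

Lemma wtE f i j : i != j ->
  [/\ ev (f * wt i j) (i, true) = ev f (j, true),
      ev (f * wt i j) (j, true) = ev f (i, false)
    & forall l, l != i -> l != j -> ev (f * wt i j) (l, true) = ev f (l, true)].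
Proof.
move=> ij; have ji : j != i by rewrite eq_sym.
have evN (h : fend n) l : ev h (l, false) = (ev h (l, true))^-1.
  by rewrite -ev_inv.
rewrite /wt !mulgA; set g := f * _; set h := g * _; set k := h * _.
have gi : ev g (i, true) = ev f (i, true) * ev f (j, true) by rewrite evM_tr.
have gj : ev g (j, true) = ev f (j, true) by rewrite evM_tr_id.
have hi : ev h (i, true) = ev g (i, true) by rewrite evM_tr_id.
have hj : ev h (j, true) = (ev f (i, true))^-1.
  by rewrite evM_tr evN gi gj invgM mulgA mulgV mul1g.
have ki : ev k (i, false) = (ev f (j, true))^-1.
  by rewrite evM_tr !evN hi hj gi invgK invgM mulgVK.
split; first by apply: invg_inj; rewrite -evN ki.
- by rewrite evM_tr_id // evN.
- by move=> l li lj; rewrite !evM_tr_id.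
Qed.

End Transvections.

(** * Cancellation and Nielsen reduction *)

Section CommonPrefix.
Variable T : eqType.
Implicit Types u v p r t : seq T.

Fixpoint lcp u v : nat :=
  match u, v with
  | a :: u', b :: v' => if a == b then (lcp u' v').+1 else 0
  | _, _ => 0
  end.

Lemma lcpC u v : lcp u v = lcp v u.
Proof. by elim: u v => [|a u IH] [|b v] //=; rewrite eq_sym IH. Qed.

Lemma lcp_sizel u v : lcp u v <= size u.
Proof. by elim: u v => [|a u IH] [|b v] //=; case: eqP => //= _; apply: IH. Qed.

Lemma lcp_sizer u v : lcp u v <= size v.
Proof. by rewrite lcpC lcp_sizel. Qed.

Lemma take_lcp u v : take (lcp u v) u = take (lcp u v) v.
Proof. by elim: u v => [|a u IH] [|b v] //=; case: eqP => //= ->; rewrite IH. Qed.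

Lemma lcp_drop u v a u' b v' : drop (lcp u v) u = a :: u' ->
  drop (lcp u v) v = b :: v' -> a != b.
Proof.
elim: u v => [|x u IH] [|y v] //=; case: eqP => [->|/eqP ne] /=; first exact: IH.
by move=> [<- _] [<- _].
Qed.

Lemma lcp_take u v m t : lcp u v < m -> m <= size v ->
  lcp u (take m v ++ t) = lcp u v.
Proof.
elim: m u v => // m IH [|x u] [|y v] //=; case: eqP => //= _ h1 h2.
by rewrite IH.
Qed.

End CommonPrefix.

Section Cancellation.
Variable n : nat.
Implicit Types (u v : seq (letter n)) (x y : fgrp n).

(** The number of letters that each factor loses in [x * y]. *)
Definition can x y := lcp (winv (fw x)) (fw y).

Lemma is_red_cat u v :
  (forall a u' b v', winv u = a :: u' -> v = b :: v' -> a != b) ->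
  is_red u -> is_red v -> is_red (u ++ v).
Proof.
case/lastP: u => [|u a]; first by [].
case: v => [|b v] h hu hv; first by rewrite cats0.
rewrite /is_red cat_rcons sorted_cat_cons [sorted _ _]hu /=.
rewrite [path _ _ _]hv andbT; rewrite eq_sym.
by apply: (h _ (winv u) _ v) => //; rewrite /winv map_rcons rev_rcons.
Qed.

(** With [p] the common prefix, [x = r^-1 p^-1] and [y = p y'], where [r] and [y'] start with
    different letters; hence nothing more cancels. *)
Lemma fwM_can x y :
  fw (x * y) = take (size (fw x) - can x y) (fw x) ++ drop (can x y) (fw y).
Proof.
set c := can x y; set u := fw x; set v := fw y.
set p := take c v; set r := drop c (winv u).
have Ep : take c (winv u) = p by apply: take_lcp.
have Eu : u = winv r ++ winv p.
  by rewrite -winv_cat -Ep cat_take_drop winvK.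
have Et : take (size u - c) u = winv r.
  have -> : size u - c = size (winv r) by rewrite size_winv size_drop size_winv.
  by rewrite {1}Eu take_size_cat.
have Ev : v = p ++ drop c v by rewrite cat_take_drop.
rewrite Et fwM -/u -/v Eu [in LHS]Ev -catA.
rewrite -reduce_catr. rewrite reduce_Vcat reduce_catr reduce_id //.
have ru : is_red u := fwP x; have rv : is_red v := fwP y.
apply: is_red_cat.
- rewrite winvK => a u' b v'; exact: lcp_drop.
- by move: ru; rewrite Eu => /cat_sorted2[].
- by move: rv; rewrite [X in is_red X -> _]Ev => /cat_sorted2[].
Qed.

Definition flen x := size (fw x).

Lemma flenV x : flen x^-1 = flen x. Proof. exact: size_winv. Qed.

Lemma can_lel x y : can x y <= flen x.
Proof. by rewrite -[flen x]size_winv lcp_sizel. Qed.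
Lemma can_ler x y : can x y <= flen y.
Proof. exact: lcp_sizer. Qed.

Lemma flenM x y : flen (x * y) + (can x y).*2 = flen x + flen y.
Proof.
have := can_lel x y; have := can_ler x y.
rewrite /flen fwM_can size_cat size_drop => h1 h2.
rewrite size_takel ?leq_subr //; lia.
Qed.

Lemma flen_eq0 x : (flen x == 0) = (x == 1).
Proof.
apply/idP/eqP => [/nilP e|->//]; apply: val_inj => /=; exact: e.
Qed.

(* A prefix of [x] longer than half of it cannot also be a prefix of [x^-1]:
   the middle letter (or the two middle letters) would cancel. *)
Lemma can_self x : x != 1 -> (can x x).*2 < flen x.
Proof.
rewrite -flen_eq0 -lt0n /can /flen => x0; rewrite ltnNge; apply/negP => h.
set u := fw x in x0 h.
have a0 : letter n by case: u x0 {h} => // a.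
have [L [Lu [hL ES]]] : exists L, L < size u /\ L <= lcp (winv u) u /\
    (size u = L.*2.+1 \/ size u = L.*2).
  by exists (size u)./2; have := odd_double_half (size u); case: odd => /=; lia.
have nthW i : i < size u -> nth a0 (winv u) i = inv_letter (nth a0 u (size u - i.+1)).
  by move=> hi; rewrite nth_rev ?size_map // (nth_map a0) //; lia.
have E i : i < lcp (winv u) u -> nth a0 (winv u) i = nth a0 u i.
  move=> hi; rewrite -(nth_take a0 hi) take_lcp nth_take //.
case: ES => ES.
  have hl : L < lcp (winv u) u by lia.
  have := E _ hl; rewrite nthW; last by lia.
  have -> : size u - L.+1 = L by lia.
  by move/eqP; rewrite (negbTE (inv_letter_neq _)).
have hl : L.-1 < lcp (winv u) u by lia.
have := E _ hl; rewrite nthW; last by lia.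
have -> : size u - L.-1.+1 = L.-1.+1 by lia.
move=> e; have ru : is_red u := fwP x.
have hs : L.-1.+1 < size u by lia.
have := (sortedP a0 ru L.-1 hs).
by rewrite -e inv_letterK eqxx.
Qed.

End Cancellation.

Section HalfRank.
Variable n : nat.
Implicit Types (u v p q : seq (letter n)) (x y : fgrp n).

(* The lexicographic rank of a word among the words of the same length. *)
Definition nu u : nat :=
  foldl (fun m (a : letter n) =>
           m * #|{: 'I_n * bool}| + enum_rank (a : 'I_n * bool))%N 0%N u.

Lemma nu_rcons u (a : letter n) :
  nu (rcons u a) = (nu u * #|{: 'I_n * bool}| + enum_rank (a : 'I_n * bool))%N.
Proof. by rewrite /nu foldl_rcons. Qed.

Lemma nu_cat_lt p q t : nu p < nu q -> nu (p ++ t) < nu (q ++ t).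
Proof.
elim/last_ind: t => [|t a IH] h; first by rewrite !cats0.
rewrite -!rcons_cat !nu_rcons ltn_add2r ltn_pmul2r ?IH //.
by apply: leq_ltn_trans (ltn_ord (enum_rank (a : 'I_n * bool))).
Qed.

Lemma nu_inj p q : size p = size q -> nu p = nu q -> p = q.
Proof.
elim/last_ind: p q => [|p a IH] q; first by case: q.
case/lastP: q => [|q b]; rewrite !size_rcons // => -[hs].
rewrite !nu_rcons => e.
have B0 := leq_ltn_trans (leq0n _) (ltn_ord (enum_rank (a : 'I_n * bool))).
have := congr1 (modn^~ #|{: 'I_n * bool}|) e.
rewrite /= !modnMDl !modn_small // => /val_inj /enum_rank_inj ab.
move: e; rewrite ab => /addIn /eqP; rewrite eqn_pmul2r // => /eqP /IH -> //.
Qed.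

(** Rounding up puts the middle letter of an odd word into both the initial and the final half. *)
Definition half u := take (uphalf (size u)) u.
Definition mu x := (nu (half (fw x)) + nu (half (fw x^-1)))%N.

Lemma muV x : mu x^-1 = mu x.
Proof. by rewrite /mu invgK addnC. Qed.

(** As [q] has at most half the length, the initial half of the inverse lies inside the inverse of
    [t], so only the first summand of [mu] changes. *)
Lemma mu_lt x y p q t : fw x = p ++ t -> fw y = q ++ t -> size p = size q ->
  (size q).*2 <= flen y -> nu p < nu q -> mu x < mu y.
Proof.
move=> ex ey pq hq lt_pq.
have sxy : size (fw x) = size (fw y) by rewrite ex ey !size_cat pq.
rewrite /flen in hq; have hu := uphalf_half (size (fw y)).
have ho := odd_double_half (size (fw y)).
have es : size (fw y) = size q + size t by rewrite ey size_cat.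
have hl : nu (half (fw x)) < nu (half (fw y)).
  rewrite /half sxy ex ey !take_cat pq [_ < size q]ltnNge.
  have -> /= : size q <= uphalf (size (q ++ t)).
    by rewrite -ey hu; case: odd ho; lia.
  exact: nu_cat_lt.
rewrite /mu; suff -> : half (fw x^-1) = half (fw y^-1) by rewrite ltn_add2r.
rewrite /half !fwV !size_winv sxy ex ey !winv_cat !takel_cat //.
  by rewrite size_winv -ey hu; case: odd ho; lia.
by rewrite size_winv -ey hu; case: odd ho; lia.
Qed.

End HalfRank.

Section NielsenReduced.
Variable n : nat.
Implicit Types (a b d : letter n) (f : fend n).

(** Minimality under every Nielsen move [f a -> f a f b], first in length and then in [mu]. *)
Definition reduced_end f := forall a b, a.1 != b.1 ->
  flen (ev f a) <= flen (ev f a * ev f b) /\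
  (flen (ev f a) = flen (ev f a * ev f b) -> mu (ev f a) <= mu (ev f a * ev f b)).

Variable f : fend n.
Hypothesis fR : reduced_end f.
Hypothesis f_neq1 : forall a, ev f a != 1.

Local Notation c a b := (can (ev f a) (ev f b)).

(** Minimality at [a] against [b] bounds the cancellation by half of [f b], and minimality at [b^-1]
    against [a^-1] bounds it by half of [f a]. Equal indices force [b = a], which [can_self]
    settles. *)
Lemma reduced_can_half a b : b != inv_letter a ->
  (c a b).*2 <= flen (ev f a) /\ (c a b).*2 <= flen (ev f b).
Proof.
move=> nab; have [e|ne] := eqVneq a.1 b.1.
  have -> : b = a.
    by case: a b e nab => i [] [j []] /= <-; rewrite /inv_letter /= ?eqxx.
  have := can_self (f_neq1 a); lia.
have [h1 _] := fR ne.
have [|h2 _] := @fR (inv_letter b) (inv_letter a); first by rewrite eq_sym.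
have := flenM (ev f a) (ev f b).
move: h2; rewrite !ev_inv -invgM !flenV; move: (flen (_ * _)) h1 => C h1; lia.
Qed.

(** The product [f b f d = p t] has the length of [f d] and a smaller [mu], so replacing [f d] by it
    contradicts minimality. *)
Lemma reduced_no_swap b d p q t : b.1 != d.1 ->
  fw (ev f b) = p ++ winv q -> fw (ev f d) = q ++ t -> size p = size q ->
  c b d = size q -> (size q).*2 <= flen (ev f d) -> nu p < nu q -> False.
Proof.
move=> bd eb ed pq hc hd lt_pq.
have e : fw (ev f b * ev f d) = p ++ t.
  rewrite fwM_can hc eb ed drop_size_cat // size_cat size_winv addnK.
  by rewrite take_size_cat.
have := mu_lt e ed pq hd lt_pq.
have [|_] := @fR (inv_letter d) (inv_letter b); first by rewrite eq_sym.
rewrite !ev_inv -invgM !flenV !muV => h.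
rewrite ltnNge h //.
by rewrite /flen e ed !size_cat pq.
Qed.

(** Otherwise the neighbours cancel exactly one half of [f b] each, so [f b = p q^-1] with [p] and
    [q] of equal length. If [nu p] and [nu q] differ, [d] or [a] admits a forbidden move; if they
    agree, [p = q] and [f b = 1]. *)
Lemma reduced_can_lt a b d : b != inv_letter a -> d != inv_letter b ->
  c a b + c b d < flen (ev f b).
Proof.
move=> ab bd; rewrite ltnNge; apply/negP => h.
have [ha1 hb1] := reduced_can_half ab; have [hb2 hd2] := reduced_can_half bd.
have b0 : 0 < flen (ev f b) by rewrite lt0n flen_eq0.
have e12 : c a b = c b d by lia.
have eh : (c a b).*2 = flen (ev f b) by lia.
have ab1 : b.1 != a.1.
  apply/eqP => e; have E := letter_eq (esym e) ab.
  by have := can_self (f_neq1 b); move: eh; rewrite E; lia.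
have bd1 : b.1 != d.1.
  apply/eqP => e; have E := letter_eq e bd.
  by have := can_self (f_neq1 b); move: e12 eh; rewrite E; lia.
set k := c a b in e12 eh ha1.
set p := take k (fw (ev f b)); set q := take k (fw (ev f d)).
have sp : size p = k by rewrite size_takel // -/(flen _); lia.
have sq : size q = k by rewrite size_takel // -/(flen _); lia.
have Ea : winv (fw (ev f a)) = p ++ drop k (winv (fw (ev f a))).
  by rewrite /p /k /can -take_lcp cat_take_drop.
have Ed : fw (ev f d) = q ++ drop k (fw (ev f d)) by rewrite cat_take_drop.
have Eb : fw (ev f b) = p ++ winv q.
  rewrite -[LHS](cat_take_drop k) -/p; congr (_ ++ _).
  have -> : q = take k (winv (fw (ev f b))) by rewrite /q e12 /can take_lcp.
  rewrite -{2}[fw (ev f b)](cat_take_drop k) winv_cat take_size_cat ?winvK //.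
  by rewrite size_winv size_drop -/(flen _); lia.
have [lt_pq|lt_qp|e_pq] := ltngtP (nu p) (nu q).
- apply: (reduced_no_swap bd1 Eb Ed _ _ _ lt_pq); rewrite ?sp ?sq // -?e12 //.
  by move: hd2; rewrite -e12.
- apply: (@reduced_no_swap (inv_letter b) (inv_letter a) q p _ ab1 _ _ _ _ _ lt_qp).
  + by rewrite ev_inv fwV Eb winv_cat winvK.
  + by rewrite ev_inv fwV; exact: Ea.
  + by rewrite sp sq.
  + by rewrite /can !ev_inv !fwV winvK lcpC sp.
  + by rewrite ev_inv flenV sp.
have E : p = q by apply: nu_inj => //; rewrite sp sq.
case/eqP: (f_neq1 b); rewrite -[LHS]ofwK Eb E.
by rewrite ofw_cat ofw_winv mulgV.
Qed.

Definition tcan a w := if w is b :: _ then c a b else 0%N.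

(** By [reduced_can_lt] every factor keeps at least one letter, and the first factor loses letters
    only to its immediate successor. *)
Lemma reduced_prod a w : is_red (a :: w) ->
  exists2 t, fw (\prod_(x <- a :: w) ev f x) =
     take (flen (ev f a) - tcan a w) (fw (ev f a)) ++ t & size w <= size t.
Proof.
elim: w a => [|b w IH] a /=.
  move=> _; exists [::] => //; rewrite big_seq1 subn0 cats0 /flen.
  by rewrite take_size.
case/andP => ab hw; have [t e st] := IH b hw.
rewrite big_cons; set P := \prod_(_ <- _) _ in e *.
have b0 : 0 < flen (ev f b) by rewrite lt0n flen_eq0.
(* What survives of [f b] in the remaining product is longer than [c a b], so [f a] cancels against
   that product exactly as against [f b]. *)
have hlt : c a b < flen (ev f b) - tcan b w.
  case: w hw {IH e st P} => [|d w] /=.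
    by have := reduced_can_half ab; lia.
  by case/andP => bd _; have := reduced_can_lt ab bd; lia.
have ecan : can (ev f a) P = c a b.
  by rewrite /can e lcp_take // leq_subr.
eexists; first by rewrite fwM_can ecan.
rewrite size_drop e size_cat size_takel ?leq_subr //; lia.
Qed.

Lemma reduced_prod_size w : is_red w -> size w <= flen (\prod_(x <- w) ev f x).
Proof.
case: w => [|a w] // h; have [t e st] := reduced_prod h.
rewrite /flen e size_cat size_takel ?leq_subr //=.
have a0 : 0 < flen (ev f a) by rewrite lt0n flen_eq0.
suff : tcan a w < flen (ev f a) by lia.
case: w h {st t e} => [|b w] //= /andP[ab _].
by have := reduced_can_half ab; lia.
Qed.

End NielsenReduced.

(** * Signed permutations and Nielsen's generation theorem *)

Section Flip.
Variables (n : nat) (p : 'I_n).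

Definition flip : fend n := [ffun i => gl (i, i != p)].

Lemma det_flip : (\det (abF flip) = -1)%R.
Proof.
have -> : abF flip = diag_mx (\row_l (if l == p then -1 else 1)%R).
  apply/matrixP => l c; rewrite !mxE ffunE expsum_gl /=.
  by case: (l == p); case: (l == c).
rewrite det_diag (bigD1 p) //= mxE eqxx big1 ?mulr1 // => l lp.
by rewrite mxE (negbTE lp).
Qed.

End Flip.

Section NielsenGeneration.
Variable n : nat.
Hypothesis n_gt2 : 2 < n.
Implicit Types (a b c : letter n) (f g w : fend n) (i j l : 'I_n).

Lemma det_abF_unit f g : f * g = 1 -> (\det (abF f) * \det (abF g) = 1)%R.
Proof. by move=> e; rewrite mulrC -det_mulmx -abFM e abF1 det1. Qed.

Lemma third_index i j : exists l : 'I_n, l != i /\ l != j.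
Proof.
have : 0 < #|~: [set i; j]|.
  by have := cardsC [set i; j]; have := cards2 i j; rewrite card_ord; lia.
by case/card_gt0P => l; rewrite !inE negb_or => /andP[h1 h2]; exists l.
Qed.

(* [tr a b] is a commutator, through a third index. *)
Lemma det_abF_tr a b : a.1 != b.1 -> (\det (abF (tr a b)) = 1)%R.
Proof.
move=> ab; have [l [la lb]] := third_index a.1 b.1.
have la' : a.1 != l by rewrite eq_sym.
rewrite -(@tr_comm3 _ a (l, true) b) // !abFM !det_mulmx.
have e1 := det_abF_unit (@trVK _ a (l, true) la').
have e2 := det_abF_unit (@trVK _ (l, true) b lb).
rewrite -[RHS](mulr1 1%R) -{1}e1 -e2; ring.
Qed.

Variable H : fend n -> Prop.
Hypothesis H1 : H 1.
Hypothesis HM : forall f g, H f -> H g -> H (f * g).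
Hypothesis Htr : forall a b, a.1 != b.1 -> H (tr a b).

(** The inverse is what must lie in [H]: it carries membership from [f * w] back to [f]. The
    determinant keeps [f * w] inside Aut^+. *)
Let elem f := exists g, [/\ f * g = 1, g * f = 1, H g & (\det (abF f) = 1)%R].

Let elem_tr a b : a.1 != b.1 -> elem (tr a b).
Proof.
move=> ab; exists (tr a (inv_letter b)); split; rewrite ?trK ?trVK ?det_abF_tr //.
exact: Htr.
Qed.

Let elemM f g : elem f -> elem g -> elem (f * g).
Proof.
move=> [f' [f1 f2 f3 f4]] [g' [g1 g2 g3 g4]]; exists (g' * f'); split.
- by rewrite mulgA -[f * g * g']mulgA g1 mulg1.
- by rewrite mulgA -[g' * f' * f]mulgA f2 mulg1.
- exact: HM.
- by rewrite abFM det_mulmx f4 g4 mulr1.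
Qed.

Let elem_wt i j : i != j -> elem (wt i j).
Proof.
move=> ij; have ji : j != i by rewrite eq_sym.
by apply: elemM; [apply: elemM|]; apply: elem_tr.
Qed.

Let autpM f w : elem w -> autp f -> autp (f * w).
Proof.
move=> [v [wv vw _ dw]] [[g [fg gf]] df]; split.
  exists (v * g); split; first by rewrite mulgA -[f * w * v]mulgA wv mulg1.
  by rewrite mulgA -[v * g * f]mulgA gf mulg1.
by rewrite abFM det_mulmx df dw mulr1.
Qed.

Let elem_cancel f w : elem w -> H (f * w) -> H f.
Proof.
move=> [v [wv _ Hv _]] Hfw; rewrite -[f]mulg1 -wv mulgA; exact: HM.
Qed.

Lemma gl_index_inj a b : gl a = gl b \/ gl a = (gl b)^-1 -> a.1 = b.1.
Proof. by case=> [/gl_inj -> //|]; rewrite -gl_inv => /gl_inj ->. Qed.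

(** By counting, such an [f] permutes the generators up to inversion. *)
Let surj f := forall i, exists a, ev f a = gl (i, true).

Let surj_wt f i j : i != j -> surj f -> surj (f * wt i j).
Proof.
move=> ij sf l; have [[m s] e] := sf l.
have [e1 e2 e3] := wtE f ij.
have mono p q : ev (f * wt i j) p = ev f q ->
    forall t, exists a, ev (f * wt i j) a = ev f (q.1, t).
  move=> E t; have [<-|ne] := eqVneq q.2 t; first by exists p; rewrite E; case: q E.
  exists (inv_letter p); rewrite ev_inv E -ev_inv; congr (ev f _).
  by case: q ne {E} => x; case: t => [] [].
rewrite -e; have [->|mj] := eqVneq m j; first exact: mono e1 s.
have [->|mi] := eqVneq m i; first exact: mono e2 s.
exact: mono (e3 m mi mj) s.
Qed.

Let moved f := [pred i | f i != gl (i, true)].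

(** Quarter turns put one generator after another back in place. When only signs are left, the
    square of a quarter turn removes two of them, and a single one is excluded by the
    determinant. *)
Lemma signed_perm_gen f : autp f -> surj f -> H f.
Proof.
have [m] := ubnP #|moved f|; elim: m f => // m IH f; rewrite ltnS => hm af sf.
have step i j s : f i != gl (i, true) -> i != j -> ev f (j, s) = gl (i, true) -> H f.
  move=> fi ij fj; have ji : j != i by rewrite eq_sym.
  have fj' : f j != gl (j, true).
    apply: contra ij => /eqP E; apply/eqP.
    apply: (@gl_index_inj (i, true) (j, true)); rewrite -fj /ev /= E.
    by case: s {fj}; [left|right].
  suff [w [ew sw wi wl]] : exists w, [/\ elem w, surj (f * w),
      ev (f * w) (i, true) = gl (i, true) &
      forall l, l != i -> l != j -> ev (f * w) (l, true) = ev f (l, true)].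
    apply: (elem_cancel ew); apply: IH => //; last exact: autpM.
    apply: (leq_trans _ hm); apply: proper_card; apply/properP; split.
      apply/subsetP => l; rewrite !inE; apply: contra => /eqP El.
      have [li|li] := eqVneq l i; first by move: fi; rewrite -li El eqxx.
      have [lj|lj] := eqVneq l j; first by move: fj'; rewrite -lj El eqxx.
      by have := wl l li lj; rewrite /ev /= => ->; rewrite El.
    exists i; rewrite !inE // negbK.
    by move: wi; rewrite /ev /= => ->.
  (* The direction of the quarter turn is chosen so that [x_i] comes out uninverted. *)
  case: s fj => fj.
    exists (wt i j); have [e1 e2 e3] := wtE f ij.
    by split; [exact: elem_wt | exact: surj_wt | rewrite e1 | exact: e3].
  exists (wt j i); have [e1 e2 e3] := wtE f ji.
  by split; [exact: elem_wt | exact: surj_wt | rewrite e2 | move=> l li lj; apply: e3].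
have [i /= fi|f1] := pickP (moved f); last first.
  suff -> : f = 1 by [].
  by apply/ffunP => i; rewrite ffunE; have /negbFE/eqP := f1 i.
have [[j s] fj] := sf i.
have [ij|ij] := eqVneq i j; last exact: step fi ij fj.
have {s fj} fi' : ev f (i, true) = gl (i, false).
  move: fj fi; rewrite -ij /ev; case: s => /= e; first by rewrite e eqxx.
  by move=> _; rewrite -[f i]invgK e -gl_inv.
have [i' /= /andP[ii' fi2]|f1] := pickP [pred i' | (i' != i) && (f i' != gl (i', true))].
  have [[j' s] fj'] := sf i'.
  have [ij'|ij'] := eqVneq i' j'; last exact: step fi2 ij' fj'.
  have {s fj'} fi2' : ev f (i', false) = gl (i', true).
    by move: fj' fi2; rewrite -ij' /ev; case: s => /= // ->; rewrite eqxx.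
  have ne : i != i' by rewrite eq_sym.
  have [e1 e2 e3] := wtE f ne; have [e4 e5 e6] := wtE (f * wt i i') ne.
  have ew := elem_wt ne.
  apply: (elem_cancel ew); apply: (elem_cancel ew).
  apply: IH; [|by do 2!apply: (autpM ew)|by do 2!apply: (surj_wt ne)].
  apply: (leq_trans _ hm); apply: proper_card; apply/properP; split.
    apply/subsetP => l; rewrite !inE; apply: contra => /eqP El.
    have [li|li] := eqVneq l i; first by move: fi; rewrite -li El eqxx.
    have [lj|lj] := eqVneq l i'; first by move: fi2; rewrite -lj El eqxx.
    by have := e6 l li lj; rewrite e3 // /ev /= => ->; rewrite El.
  exists i; rewrite !inE // negbK.
  move: e4; rewrite e2 -[(i, false)]/(inv_letter (i, true)) ev_inv fi' /ev /= => ->.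
  by rewrite -gl_inv.
have [_ /eqP] := af; suff -> : (\det (abF f) = -1)%R by [].
suff -> : f = flip i by exact: det_flip.
apply/ffunP => l; rewrite ffunE; have [->|li] := eqVneq l i; first exact: fi'.
by have := f1 l; rewrite /= li /= => /negbFE/eqP.
Qed.

(** Only one term changes; adding it crosswise avoids subtraction of naturals. Invariance under
    inversion lets [F] be read at a letter of either sign. *)
Lemma sum_tr (F : fgrp n -> nat) f a b : (forall x, F x^-1 = F x) ->
  (\sum_i F ((f * tr a b)%g i) + F (ev f a) = \sum_i F (f i) + F (ev f a * ev f b)%g)%N.
Proof.
move=> FV; have Fev g : F (ev g a) = F (g a.1) by rewrite /ev; case: a.2.
rewrite -evM_tr !Fev (bigD1 a.1) //= [in RHS](bigD1 a.1) //=.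
rewrite (eq_bigr (fun i => F (f i))) => [|i ia]; first by lia.
by have := @evM_tr_id _ f a b (i, true) ia; rewrite /ev /= => ->.
Qed.

(** The reduced word [g x_i] has image [x_i], of length one, so by [reduced_prod_size] it has at
    most one letter; it is not empty. *)
Lemma reduced_surj f : autp f -> reduced_end f -> surj f.
Proof.
move=> [[g [fg gf]] _] fR.
have f_neq1 a : ev f a != 1.
  apply/eqP => e; have := congr1 (ext g) e.
  by rewrite -evM gf ext1 ev1 => /(congr1 (@fw n)).
have letterize i : exists a, ev f a = gl (i, true).
  have e : ext f (g i) = gl (i, true).
    by have := congr1 (fun h : fend n => h i) fg; rewrite ffunE => ->; rewrite ffunE.
  have := reduced_prod_size fR f_neq1 (fwP (g i)); rewrite [X in flen X]e.
  case E : (fw (g i)) => [|a [|b w]] // _.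
    by move: e; rewrite -[g i]ofwK E ext1 => /(congr1 (@fw n)).
  by exists a; rewrite -e -[g i]ofwK E ext_gl.
exact: letterize.
Qed.

(** Descent on total length (outer induction), then on total [mu] (inner induction). *)
Theorem nielsen f : autp f -> H f.
Proof.
have [m] := ubnP (\sum_i flen (f i)); elim: m f => // m IHm f.
have [k] := ubnP (\sum_i mu (f i)); elim: k f => // k IHk f hk hm af.
pose P (a b : 'I_n * bool) := (a.1 != b.1) &&
  ((flen (ev f a * ev f b) < flen (ev f a)) ||
   (flen (ev f a * ev f b) == flen (ev f a)) && (mu (ev f a * ev f b) < mu (ev f a))).
have [[a b] /= /andP[ab hP]|noP] := pickP (fun x : ('I_n * bool) * ('I_n * bool) => P x.1 x.2).
  have ew := elem_tr ab; apply: (elem_cancel ew).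
  have hl := @sum_tr (@flen n) f a b (@flenV n).
  have hmu := @sum_tr (@mu n) f a b (@muV n).
  have aw := autpM ew af.
  case/orP: hP => [lt|/andP[/eqP eq lt]]; last by apply: IHk => //; lia.
  by apply: IHm => //; lia.
apply: signed_perm_gen => //; apply: reduced_surj => // a b ab.
have := noP (a, b); rewrite /P /= ab /= => /negbT; rewrite negb_or -leqNgt => /andP[h1].
rewrite negb_and => h2; split=> // e; move: h2; rewrite e eqxx /=.
by rewrite -leqNgt.
Qed.

End NielsenGeneration.

(** * Elementary matrices *)

Section SpecialLinear.
Variable n : nat.
Hypothesis n_gt2 : 2 < n.
Local Open Scope ring_scope.
Implicit Types (A B : 'M[int]_n) (i j l r s : 'I_n) (x y : int).

Definition elmx i j x : 'M[int]_n := 1%:M + x *: delta_mx i j.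
Definition rowop i j x A : 'M[int]_n :=
  \matrix_(l, c) (A l c + if l == i then x * A j c else 0).

Lemma elmx_mul i j x A : elmx i j x *m A = rowop i j x A.
Proof.
rewrite mulmxDl mul1mx -scalemxAl; apply/matrixP => l c; rewrite !mxE; congr (_ + _).
rewrite (bigD1 j) //= big1 ?addr0 => [|p pj]; last first.
  by rewrite mxE (negbTE pj) andbF mul0r.
by rewrite mxE eqxx andbT; case: eqP => _; rewrite ?mul1r // mul0r mulr0.
Qed.

Lemma elmxD i j x y : i != j -> elmx i j (x + y) = elmx i j x *m elmx i j y.
Proof.
move=> ij; rewrite elmx_mul; apply/matrixP => l c; rewrite !mxE.
have [_|_] := eqVneq l i; rewrite ?mul0r /=; last by rewrite mulr0n ?andFb ?mulr0 ?addr0.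
rewrite eq_sym in ij; rewrite (negbTE ij) /= mulr0 addr0 -addrA mulrDl.
by rewrite [x * _ + y * _]addrC; congr (_ + (_ + _ * _)); rewrite eq_sym.
Qed.

Lemma elmx0 i j : elmx i j 0 = 1%:M.
Proof. by rewrite /elmx scale0r addr0. Qed.

Lemma elmx_tr i j (s : bool) : i != j ->
  abF (tr (i, true) (j, s)) = elmx i j (if s then 1 else -1).
Proof.
move=> ij; apply/matrixP => l c; rewrite !mxE ffunE /=.
have [->|li] := eqVneq l i; last by rewrite expsum_gl /= mulr0 addr0; case: eqP.
rewrite expsumM !expsum_gl /= [c == j]eq_sym; case: (i == c) => /=;
  by case: (j == c); rewrite ?mulr1 ?mulr0.
Qed.

Variable K : 'M[int]_n -> Prop.
Hypothesis K1 : K 1%:M.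
Hypothesis KM : forall A B, K A -> K B -> K (A *m B).
Hypothesis Ktr : forall a b : letter n, a.1 != b.1 -> K (abF (tr a b)).

(** Each step by 1 or -1 from 0 towards [x] is the image of a transvection. *)
Let K_elmx i j x : i != j -> K (elmx i j x) /\ \det (elmx i j x) = 1.
Proof.
move=> ij; have K1x (s : bool) :
    K (elmx i j (if s then 1 else -1)) /\ \det (elmx i j (if s then 1 else -1)) = 1.
  by rewrite -elmx_tr //; split; [exact: Ktr | exact: det_abF_tr].
elim: x => [|m [IH1 IH2]|m [IH1 IH2]]; first by rewrite elmx0 det1.
  rewrite -addn1 PoszD elmxD // det_mulmx; have [h1 h2] := K1x true.
  by split; [exact: KM | rewrite IH2 h2].
rewrite -addn1 PoszD opprD elmxD // det_mulmx; have [h1 h2] := K1x false.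
by split; [exact: KM | rewrite IH2 h2].
Qed.

Let K_rowop i j x A : i != j -> K (rowop i j x A) -> K A.
Proof.
move=> ij h; rewrite -[A]mul1mx -(elmx0 i j) -(addNr x) elmxD // -mulmxA (elmx_mul i j x).
by apply: KM => //; have [] := K_elmx (- x) ij.
Qed.

Let det_rowop i j x A : i != j -> \det (rowop i j x A) = \det A.
Proof.
by move=> ij; rewrite -elmx_mul det_mulmx; have [_ ->] := K_elmx x ij; rewrite mul1r.
Qed.

Definition unit_cols m A := forall i j, (j < m)%N -> A i j = (i == j)%:R.

(** The source row [j] vanishes in the first [m] columns. *)
Lemma unit_cols_rowop m A i j x : (m <= j)%N -> unit_cols m A ->
  unit_cols m (rowop i j x A).
Proof.
move=> mj h l c cm; rewrite mxE !h //.
have -> : (j == c) = false by apply/negbTE/eqP => e; move: cm; rewrite -e; lia.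
by rewrite mulr0 if_same addr0.
Qed.

Section Column.
Variable c : 'I_n.
Hypothesis IHc : forall A, \det A = 1 -> unit_cols c.+1 A -> K A.

(** Entries above the pivot are cleared too, so that a finished column is one of the identity. The
    induction is on the number of nonzero entries off the pivot. *)
Let K_pivot A : \det A = 1 -> unit_cols c A -> A c c = 1 -> K A.
Proof.
have [m] := ubnP #|[pred l | (l != c) && (A l c != 0)]|.
elim: m A => // m IH A; rewrite ltnS => hm dA uA Ac.
have [l /andP[lc Al]|none] := pickP [pred l | (l != c) && (A l c != 0)]; last first.
  apply: IHc => // i j; rewrite ltnS leq_eqVlt => /orP[/eqP jc|]; last exact: uA.
  have -> : j = c by apply: val_inj.
  have [->|ic] := eqVneq i c; first by rewrite Ac.
  by have /negbT := none i; rewrite /= ic /= negbK => /eqP.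
apply: (@K_rowop l c (- A l c)) => //; apply: IH.
- apply: leq_trans hm; apply: proper_card; apply/properP; split.
    apply/subsetP => i; rewrite !inE mxE => /andP[-> /=].
    have [->|il] := eqVneq i l; first by rewrite Ac mulr1 subrr eqxx.
    by rewrite addr0.
  by exists l; rewrite !inE ?lc //= mxE eqxx Ac mulr1 subrr eqxx.
- by rewrite det_rowop.
- exact: unit_cols_rowop.
- by rewrite mxE eq_sym (negbTE lc) addr0.
Qed.

(** Row [c] of the inverse vanishes to the left of [c], so its product with column [c] reduces to
    one term involving [A r c], which is therefore a unit. *)
Let K_lone_pivot A r : \det A = 1 -> unit_cols c A -> (c <= r)%N ->
  (forall s, (c <= s)%N -> s != r -> A s c = 0) -> K A.
Proof.
move=> dA uA cr A0.
have uni : A r c * A r c = 1.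
  have [B eB] : exists B, B *m A = 1%:M by exists (\adj A); rewrite mul_adj_mx dA.
  have Bc s : (s < c)%N -> B c s = 0.
    move=> sc; have /matrixP/(_ c s) := eB; rewrite !mxE (bigD1 s) //= uA // eqxx mulr1.
    rewrite big1 => [|p ps]; last by rewrite uA // (negbTE ps) mulr0.
    by rewrite addr0 => ->; case: eqP => // e; move: sc; rewrite -e ltnn.
  have /matrixP/(_ c c) := eB; rewrite !mxE eqxx (bigD1 r) //= big1 ?addr0 => [e|s sr].
    have /eqP := congr1 absz e; rewrite abszM muln_eq1 => /andP[_ /eqP a1].
    by have [->|->] : A r c = 1 \/ A r c = -1 by lia.
  have [cs|sc] := leqP c s; first by rewrite A0 ?mulr0.
  by rewrite Bc ?mul0r.
have [rc|rc] := eqVneq r c; last first.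
  have cr' : c != r by rewrite eq_sym.
  apply: (@K_rowop c r (A r c)) => //; apply: K_pivot.
  - by rewrite det_rowop.
  - exact: unit_cols_rowop.
  - by rewrite mxE eqxx A0 // add0r.
have [A1|A1] := eqVneq (A c c) 1; first exact: K_pivot.
have Ac : A c c = -1.
  apply/eqP; move/eqP: uni; rewrite rc -expr2 sqrf_eq1 => /orP[/eqP e|//].
  by move: A1; rewrite e eqxx.
have [l cl|last_c] := pickP [pred l : 'I_n | (c < l)%N].
  rewrite /= in cl; have lc : l != c by apply/eqP => e; move: cl; rewrite e ltnn.
  have lc' : c != l by rewrite eq_sym.
  (* In column [c], row [l] first receives the entry 1, and twice that row then turns -1 into 1. *)
  apply: (@K_rowop l c (-1)) => //; apply: (@K_rowop c l 2) => //; apply: K_pivot.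
  - by rewrite !det_rowop.
  - by apply: unit_cols_rowop; [exact: ltnW | exact: unit_cols_rowop].
  - rewrite !mxE !eqxx (negbTE lc') Ac A0 ?rc //; exact: ltnW.
(* With [c] last the matrix is upper triangular and its determinant is the pivot. *)
have : \det A = -1.
  rewrite -det_tr det_trig.
    rewrite (bigD1 c) //= mxE Ac big1 ?mulr1 // => i ic.
    rewrite mxE uA ?eqxx //; have := last_c i => /= /negbT.
    by rewrite -leqNgt leq_eqVlt => /orP[/eqP/val_inj e|//]; rewrite e eqxx in ic.
  apply/is_trig_mxP => i j ij; rewrite mxE uA.
    by case: eqP => // e; move: ij; rewrite e ltnn.
  have := last_c j => /= /negbT; rewrite -leqNgt; exact: leq_trans.
by rewrite dA.
Qed.

(** Euclid's algorithm on the entries of column [c] in rows from [c] on, measured by the sum of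
    their absolute values. *)
Lemma column_step A : \det A = 1 -> unit_cols c A -> K A.
Proof.
have [m] := ubnP (\sum_(l < n | (c <= l)%N) `|A l c|)%N.
elim: m A => // m IH A; rewrite ltnS => hm dA uA.
pose Q r s := [&& (c <= r)%N, (c <= s)%N, r != s, A s c != 0 & (`|A s c| <= `|A r c|)%N].
have [[r s] /= /and5P[cr cs rs As Ars]|none] := pickP (fun p : 'I_n * 'I_n => Q p.1 p.2).
  have [x hx] : exists x, (`|(A r c + x * A s c)%R| < `|A r c|)%N.
    by exists (if (A r c < 0) == (A s c < 0) then -1 else 1); case: ifP; lia.
  apply: (@K_rowop r s x) => //; apply: IH; last exact: unit_cols_rowop.
    apply: leq_trans hm.
    rewrite (bigD1 r) //= [X in (_ < X)%N](bigD1 r) //= mxE eqxx.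
    rewrite (eq_bigr (fun l => `|A l c|%N)) ?ltn_add2r // => i /andP[_ ir].
    by rewrite mxE (negbTE ir) addr0.
  by rewrite det_rowop.
have [r0 /andP[cr0 Ar0]|all0] := pickP [pred r : 'I_n | (c <= r)%N && (A r c != 0)].
  apply: (@K_lone_pivot A r0) => // s cs sr.
  apply/eqP; apply/negPn/negP => As.
  have := none (r0, s); have := none (s, r0); rewrite /Q /= cs cr0 sr As Ar0 /=.
  rewrite eq_sym sr /=; lia.
(* A column of zeros is passed on with [c] as pivot row; the unit argument there excludes it. *)
apply: (@K_lone_pivot A c) => // s cs _.
by apply/eqP/negPn; have /negbT := all0 s; rewrite /= cs.
Qed.

End Column.

Theorem sl_generated A : \det A = 1 -> K A.
Proof.
have cols m : (m <= n)%N -> forall B, \det B = 1 -> unit_cols (n - m) B -> K B.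
  elim: m => [|m IH] mn B dB uB.
    suff -> : B = 1%:M by [].
    by apply/matrixP => i j; rewrite mxE uB // subn0.
  have hc : (n - m.+1 < n)%N by lia.
  apply: (@column_step (Ordinal hc)) => // D dD uD.
  apply: IH => //; first lia.
  by move=> i j jm; apply: uD => /=; lia.
by move=> dA; apply: (cols n) => // i j; rewrite subnn.
Qed.

End SpecialLinear.

(** * Products of cycles *)

Section BlockRotation.
Variable k : nat.
Hypothesis k_gt0 : 0 < k.
Implicit Types a m i j l : nat.

(* Rotation by [j] of each of the [m] consecutive blocks of length [k] that
   start at [a]. *)
Definition brot a m j i :=
  if (a <= i) && (i < a + m * k)
  then a + (i - a) %/ k * k + ((i - a) %% k + j) %% k else i.

Lemma brot_block a m j q u : q < m ->
  brot a m j (a + q * k + u %% k) = a + q * k + (u + j) %% k.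
Proof.
move=> qm; have uk : u %% k < k by rewrite ltn_mod.
have hq : q.+1 * k <= m * k by rewrite leq_mul2r qm orbT.
rewrite /brot; have -> : (a <= a + q * k + u %% k < a + m * k) by rewrite mulSn in hq; lia.
have -> : a + q * k + u %% k - a = q * k + u %% k by lia.
by rewrite divnMDl // (divn_small uk) addn0 modnMDl modn_mod modnDml.
Qed.

Lemma blockP a m i : (a <= i) && (i < a + m * k) ->
  exists q u, [/\ q < m, i = a + q * k + u %% k & u < k].
Proof.
move=> /andP[h1 h2]; exists ((i - a) %/ k), ((i - a) %% k).
have := divn_eq (i - a) k; split; rewrite ?ltn_mod // ?modn_mod; last lia.
by rewrite ltn_divLR //; lia.
Qed.

Lemma brot_out a m j i : ~~ ((a <= i) && (i < a + m * k)) -> brot a m j i = i.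
Proof. by rewrite /brot => /negbTE ->. Qed.

Lemma brot_brot a m j l i : brot a m j (brot a m l i) = brot a m (l + j) i.
Proof.
have [/blockP[q [u [qm -> _]]]|o] := boolP ((a <= i) && (i < a + m * k)).
  by rewrite !brot_block // addnA.
by rewrite !(brot_out _ o).
Qed.

Lemma brot_mod a m j i : k %| j -> brot a m j i = i.
Proof.
move=> /dvdnP[x ->]; have [/blockP[q [u [qm -> _]]]|o] := boolP ((a <= i) && (i < a + m * k)).
  by rewrite brot_block // [u + _]addnC modnMDl.
exact: brot_out.
Qed.

(** A further rotation by [k.-1 * j] makes the total a multiple of [k]. *)
Lemma brot_inj a m j : injective (brot a m j).
Proof.
move=> x y e; have := congr1 (brot a m (k.-1 * j)) e.
have d : k %| j + k.-1 * j by rewrite -mulSn prednK // dvdn_mulr.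
by rewrite !brot_brot !brot_mod.
Qed.

Lemma brot_lt a m j i n : a + m * k <= n -> i < n -> brot a m j i < n.
Proof.
move=> h hi; have [/blockP[q [u [qm -> _]]]|o] := boolP ((a <= i) && (i < a + m * k)).
  rewrite brot_block //; have uk : (u + j) %% k < k by rewrite ltn_mod.
  have hq : q.+1 * k <= m * k by rewrite leq_mul2r qm orbT.
  by rewrite mulSn in hq; lia.
by rewrite brot_out.
Qed.

End BlockRotation.

Section CycleElement.
Variables (n k : nat).
Hypothesis k_gt0 : 0 < k.
Variables (a m : nat) (p : 'I_n) (e : bool).
Hypothesis amn : a + m * k <= n.
Hypothesis p_out : ~~ ((a <= p) && (p < a + m * k)).
Implicit Types (i j l : 'I_n) (c d : letter n).

(** The default of [insubd] is never taken, since the rotation stays below [n]. *)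
Definition orot t i : 'I_n := insubd i (brot k a m t i).

Lemma val_orot t i : orot t i = brot k a m t i :> nat.
Proof. by rewrite val_insubd brot_lt. Qed.

Lemma orot_inj t : injective (orot t).
Proof. by move=> i j /(congr1 val) /=; rewrite !val_orot => /brot_inj /val_inj -> //. Qed.

Lemma orot_p t i : (orot t i == p) = (i == p).
Proof.
have pp : orot t p = p by apply: val_inj; rewrite /= val_orot brot_out.
by rewrite -{1}pp (inj_eq (@orot_inj t)).
Qed.

(** The flag [e] tells whether [x_p], which lies outside the blocks, is inverted. *)
Definition cyc : fend n :=
  [ffun i => gl (orot 1 i, ~~ (e && (i == p)))].

Definition rot_letter t c : letter n :=
  (orot t c.1, c.2 (+) (e && odd t && (c.1 == p))).

Lemma ev_cyc c : ev cyc c = gl (rot_letter 1 c).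
Proof.
by case: c => i []; rewrite /ev /rot_letter ffunE /= andbT //= -gl_inv /inv_letter /= negbK.
Qed.

Lemma ev_cycX t c : ev (cyc ^+ t) c = gl (rot_letter t c).
Proof.
elim: t c => [|t IH] c.
  rewrite expg0 ev1 /rot_letter /= andbF addbF; case: c => i s /=.
  by congr (gl (_, _)); apply: val_inj; rewrite /= val_orot brot_mod.
rewrite expgS evM IH ext_gl ev_cyc /rot_letter /= orot_p andbT.
congr (gl (_, _)); first by apply: val_inj; rewrite /= !val_orot brot_brot // addn1.
by rewrite -addbA; case: e; case: (c.1 == p); case: (odd t).
Qed.

Lemma cycXk : (e -> ~~ odd k) -> cyc ^+ k = 1.
Proof.
move=> ek; apply: fendP => -[i s]; rewrite ev_cycX ev1 /rot_letter /=.
have -> : e && odd k = false by case: (e) ek => // /(_ isT)/negbTE.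
rewrite addbF; congr (gl (_, _)).
by apply: val_inj; rewrite /= val_orot brot_mod.
Qed.

Lemma cycX_tr t i j s u : i != p -> j != p ->
  cyc ^+ t * tr (i, s) (j, u) = tr (orot t i, s) (orot t j, u) * cyc ^+ t.
Proof.
move=> ip jp; rewrite (@tr_conj _ _ (rot_letter t)).
- by rewrite /rot_letter /= (negbTE ip) (negbTE jp) !andbF !addbF.
- exact: ev_cycX.
- by move=> c d /orot_inj.
Qed.

End CycleElement.

(** * Spreading transvections along the cycles *)

Section Subgroup.
Variable n : nat.
Variable H : fend n -> Prop.
Hypothesis H1 : H 1.
Hypothesis HM : forall f g, H f -> H g -> H (f * g).
Hypothesis HV : forall f g, H f -> f * g = 1 -> H g.
Implicit Types (i j l : 'I_n) (s : bool).

(** The right transvection for [s = true], the left one for [s = false]; one argument serves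
    both. *)
Definition linked s i j := H (tr (i, s) (j, s)).

Lemma linkedV s i j : i != j -> linked s i j -> H (tr (i, s) (j, ~~ s)).
Proof. by move=> ij h; apply: HV h _; rewrite -[(j, ~~ s)]/(inv_letter (j, s)) trK. Qed.

Lemma linked_trans s i j l : i != l -> l != j -> i != j ->
  linked s i l -> linked s l j -> linked s i j.
Proof.
move=> il lj ij h1 h2; rewrite /linked -(@tr_comm3 _ (i, s) (l, s) (j, s)) //.
by do 3?[apply: HM] => //; apply: linkedV.
Qed.

Lemma HX f t : H f -> H (f ^+ t).
Proof. by move=> h; elim: t => [|t IH]; rewrite ?expg0 // expgS; apply: HM. Qed.

Variable k : nat.
Hypothesis k_gt1 : 1 < k.
Let k_gt0 : 0 < k. Proof. exact: ltnW. Qed.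

Section Block.
Variables (a m : nat) (p : 'I_n) (e : bool) (q : nat).
Hypothesis amn : a + m * k <= n.
Hypothesis p_out : ~~ ((a <= p) && (p < a + m * k)).
Hypothesis Hcyc : H (cyc k a m p e).
Hypothesis cyck : cyc k a m p e ^+ k = 1.
Hypothesis qm : q < m.
Let b := a + q * k.

(** The point of block [q] with cyclic coordinate [u]; the default [p] is never taken. *)
Definition bpt u : 'I_n := insubd p (b + u %% k).

Lemma bpt_lt u : b + u %% k < n.
Proof.
have uk : u %% k < k by rewrite ltn_mod.
have hq : q.+1 * k <= m * k by rewrite leq_mul2r qm orbT.
by rewrite mulSn in hq; rewrite /b; lia.
Qed.

Lemma val_bpt u : bpt u = b + u %% k :> nat.
Proof. by rewrite val_insubd bpt_lt. Qed.

Lemma bpt_eq u v : (bpt u == bpt v) = (u == v %[mod k]).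
Proof. by rewrite -val_eqE /= !val_bpt eqn_add2l. Qed.

Lemma bpt_p u : bpt u != p.
Proof.
apply: contra p_out => /eqP <-; rewrite val_bpt.
have uk : u %% k < k by rewrite ltn_mod.
have hq : q.+1 * k <= m * k by rewrite leq_mul2r qm orbT.
by rewrite mulSn in hq; rewrite /b; lia.
Qed.

Lemma bpt_mod u v : u = v %[mod k] -> bpt u = bpt v.
Proof. by move=> h; apply/eqP; rewrite bpt_eq h. Qed.

Lemma orot_bpt t u : orot k a m t (bpt u) = bpt (u + t).
Proof. by apply: val_inj; rewrite /= val_orot // !val_bpt brot_block. Qed.

Lemma cycX_bpt t u v s s' :
  cyc k a m p e ^+ t * tr (bpt u, s) (bpt v, s') =
  tr (bpt (u + t), s) (bpt (v + t), s') * cyc k a m p e ^+ t.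
Proof. by rewrite cycX_tr ?bpt_p // !orot_bpt. Qed.

Lemma cycXV t : cyc k a m p e ^+ t * cyc k a m p e ^+ (t * k.-1) = 1.
Proof. by rewrite -expgnDr -mulnS prednK // mulnC expgnA cyck expg1n. Qed.

Lemma H_conj t f g : H f -> cyc k a m p e ^+ t * f = g * cyc k a m p e ^+ t -> H g.
Proof.
move=> Hf E; rewrite -[g]mulg1 -(cycXV t) mulgA -E.
by apply: HM; [apply: HM => //|]; apply: HX.
Qed.

Definition linked_step s d := forall u, linked s (bpt u) (bpt (u + d)).

(** Conjugation by powers of the cycle carries one pair to all pairs at the same cyclic distance. *)
Lemma linked_stepP s u d : linked s (bpt u) (bpt (u + d)) -> linked_step s d.
Proof.
(* The exponent is [v - u] modulo [k], written without truncated subtraction. *)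
move=> h v; have := H_conj h (cycX_bpt (v + u * k.-1) u (u + d) s s).
have E x : x + u + (v + u * k.-1) = x + v %[mod k].
  have -> : x + u + (v + u * k.-1) = u * k + (x + v).
    by rewrite -{2}(prednK k_gt0) mulnS; lia.
  by rewrite modnMDl.
have := E 0; rewrite !add0n => E0; rewrite /linked (bpt_mod E0).
by have := E d; rewrite [d + u]addnC [d + v]addnC => Ed; rewrite (bpt_mod Ed).
Qed.

(** The three conditions keep [u], [u + d] and [u + d + d'] distinct modulo [k], as the commutator
    relation requires. *)
Lemma linked_stepD s d d' : d %% k != 0 -> d' %% k != 0 -> (d + d') %% k != 0 ->
  linked_step s d -> linked_step s d' -> linked_step s (d + d').
Proof.
have ne v x : x %% k != 0 -> bpt v != bpt (v + x).
  move=> hx; rewrite bpt_eq -{1}[v]addn0 eqn_modDl mod0n eq_sym //.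
move=> hd hd' hdd h h' u; apply: (@linked_trans _ _ _ (bpt (u + d))).
- exact: ne.
- by rewrite addnA; exact: ne.
- exact: ne.
- exact: h.
- by rewrite addnA; exact: h'.
Qed.

Lemma linked_step1_all s : linked_step s 1 ->
  forall d, 0 < d < k -> linked_step s d.
Proof.
move=> st1; elim=> // d IH /andP[_ dk]; case: d IH dk => // d IH dk.
rewrite -addn1; apply: linked_stepD => //; rewrite ?modn_small //; try lia.
by apply: IH; lia.
Qed.

Lemma linked_block s (i j : 'I_n) : (forall d, 0 < d < k -> linked_step s d) ->
  b <= i < b + k -> b <= j < b + k -> i != j -> linked s i j.
Proof.
move=> h hi hj ij.
have -> : i = bpt (i - b).
  by apply: val_inj; rewrite /= val_bpt modn_small; lia.
(* The added offset represents [j - i] modulo [k]. *)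
have -> : j = bpt ((i - b) + ((j - b) + (k - (i - b)))).
  apply: val_inj; rewrite /= val_bpt.
  have -> : i - b + (j - b + (k - (i - b))) = 1 * k + (j - b) by lia.
  by rewrite modnMDl modn_small; lia.
have -> : linked s (bpt (i - b)) (bpt (i - b + (j - b + (k - (i - b))))) =
  linked s (bpt (i - b)) (bpt (i - b + (j - b + (k - (i - b))) %% k)).
  congr (linked _ _ _); apply: bpt_mod; by rewrite modnDmr.
apply: h; rewrite ltn_mod k_gt0 andbT lt0n.
have ijn : (i : nat) != j by [].
have [lt|ge] := ltnP j i.
  by rewrite modn_small; lia.
have -> : j - b + (k - (i - b)) = 1 * k + (j - i) by lia.
by rewrite modnMDl modn_small; lia.
Qed.

Definition linked_below s h :=
  forall i j, i < h -> j < h -> i != j -> linked s i j.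

(** The block meets the linked range in [b] and [b + 1], which gives step 1 and hence the whole
    block; pairs not inside one of the two ranges are joined through [b]. *)
Lemma linked_below_block s h : b.+1 < h -> h <= b + k ->
  linked_below s h -> linked_below s (b + k).
Proof.
move=> bh hb lh.
have st1 : linked_step s 1.
  apply: (@linked_stepP s 0); apply: lh; rewrite ?val_bpt ?mod0n ?modn_small; try lia.
  by rewrite bpt_eq mod0n modn_small.
have blk := linked_block (linked_step1_all st1).
have bn : b < n by have := bpt_lt 0; rewrite mod0n addn0.
pose c : 'I_n := Ordinal bn.
move=> i j hi hj ij.
have lc (x : 'I_n) : x < b -> linked s x c /\ linked s c x.
  by move=> xb; split; apply: lh; rewrite -?val_eqE /=; lia.
have bc (x : 'I_n) : h <= x < b + k -> linked s x c /\ linked s c x.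
  by move=> xb; split; apply: blk; rewrite -?val_eqE /=; lia.
have [ih|ih] := ltnP i h; have [jh|jh] := ltnP j h; first exact: lh.
- have [ib|ib] := leqP b i; first by apply: blk => //; lia.
  apply: (@linked_trans _ _ _ c) => //; rewrite -?val_eqE /=; try lia.
    by have [] := lc i ib.
  by have [|] := bc j; first lia.
- have [jb|jb] := leqP b j; first by apply: blk => //; lia.
  apply: (@linked_trans _ _ _ c) => //; rewrite -?val_eqE /=; try lia.
    by have [|] := bc i; first lia.
  by have [] := lc j jb.
- by apply: blk => //; lia.
Qed.

Section FirstBlock.
Hypothesis k_gt4 : 4 < k.
Variable s : bool.

Local Notation P := (bpt).
Local Notation T u v := (tr (P u, s) (P v, s)).
Local Notation T' u v := (tr (P u, s) (P v, ~~ s)).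

Hypothesis Hconj : H (T 0 1 * cyc k a m p e * T' 0 1).

Let P_neq u v : u < k -> v < k -> u != v -> P u != P v.
Proof. by move=> uk vk uv; rewrite bpt_eq !modn_small. Qed.

Let P_neqS u : P u != P u.+1.
Proof.
rewrite bpt_eq -{1}[u]addn0 -[u.+1]addn1 eqn_modDl.
by rewrite mod0n modn_small.
Qed.

Let TK u : T u u.+1 * T' u u.+1 = 1.
Proof. by rewrite -[(P u.+1, ~~ s)]/(inv_letter (P u.+1, s)) trK //=. Qed.
Let T'K u : T' u u.+1 * T u u.+1 = 1.
Proof. by rewrite -[(P u.+1, ~~ s)]/(inv_letter (P u.+1, s)) trVK //=. Qed.

Let HTT_next u : H (T u u.+1 * T' u.+1 u.+2).
Proof.
have h0 : H (T 0 1 * T' 1 2).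
  have -> : T 0 1 * T' 1 2 =
      T 0 1 * cyc k a m p e * T' 0 1 * cyc k a m p e ^+ k.-1.
    rewrite -[T 0 1 * _ * _]mulgA -[X in T 0 1 * (X * _)]expg1.
    rewrite cycX_bpt !addn1 -!mulgA -expgnDr add1n.
    by rewrite prednK // cyck mulg1.
  by apply: HM => //; apply: HX.
apply: (@H_conj u _ _ h0).
by rewrite mulgA cycX_bpt -mulgA cycX_bpt mulgA.
Qed.

(** The products of consecutive pairs telescope. *)
Let HTT u x : H (T u u.+1 * T' (x + u) (x + u).+1).
Proof.
elim: x => [|x IH]; first by rewrite add0n TK.
have -> : T u u.+1 * T' (x.+1 + u) (x.+1 + u).+1 = T u u.+1 * T' (x + u) (x + u).+1 *
   (T (x + u) (x + u).+1 * T' (x + u).+1 (x + u).+2).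
  by rewrite mulgA -(mulgA (T u u.+1)) T'K mulg1.
exact: HM.
Qed.

Let HTTV u x : H (T (x + u) (x + u).+1 * T' u u.+1).
Proof.
apply: HV (HTT u x) _.
by rewrite mulgA -(mulgA (T u u.+1)) T'K mulg1 TK.
Qed.

Let comm_T u v w x t t' : u < k -> v < k -> w < k -> x < k ->
  u != w -> u != x -> w != v ->
  tr (P u, s) (P v, t) * tr (P w, s) (P x, t') =
  tr (P w, s) (P x, t') * tr (P u, s) (P v, t).
Proof. by move=> *; apply: tr_comm; apply: P_neq. Qed.

(* [T 0 2] is the commutator of [T 0 1] and [T 1 2]; these are only available
   multiplied by [T 3 4], which commutes with both. *)
Let step2 : linked_step s 2.
Proof.
apply: (@linked_stepP s 0).
rewrite /linked -(@tr_comm3 _ (P 0, s) (P 1, s) (P 2, s)); try by apply: P_neq; lia.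
have := HM (HM (HTTV 0 3) (HTT 1 2)) (HM (HTT 0 3) (HTTV 1 2)).
congr (H _).
have c1 := @comm_T 3 4 0 1 s (~~ s) ltac:(lia) ltac:(lia) ltac:(lia) ltac:(lia) isT isT isT.
have c2 := @comm_T 3 4 1 2 s s ltac:(lia) ltac:(lia) ltac:(lia) ltac:(lia) isT isT isT.
rewrite /= c1 /inv_letter /=.
rewrite -!mulgA; congr (_ * _); rewrite mulgA c2 -!mulgA; congr (_ * _).
by rewrite mulgA (TK 3) mul1g; congr (_ * _); rewrite mulgA (T'K 3) mul1g.
Qed.

(** [T 0 3] is the commutator of [T 0 1] and [T 1 3]. The latter is available by [step2], so only
    [T 0 1] needs a partner, [T 2 3], which commutes with both. *)
Let step3 : linked_step s 3.
Proof.
apply: (@linked_stepP s 0).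
rewrite /linked -(@tr_comm3 _ (P 0, s) (P 1, s) (P 3, s)); try by apply: P_neq; lia.
have V := step2 1%N.
have V' : H (T' 1 3) by apply: linkedV V; apply: P_neq; lia.
have := HM (HM (HTTV 0 2) V) (HM (HTT 0 2) V').
congr (H _).
have c1 := @comm_T 2 3 0 1 s (~~ s) ltac:(lia) ltac:(lia) ltac:(lia) ltac:(lia) isT isT isT.
have c2 := @comm_T 2 3 1 3 s s ltac:(lia) ltac:(lia) ltac:(lia) ltac:(lia) isT isT isT.
have c3 := @comm_T 2 3 0 1 s s ltac:(lia) ltac:(lia) ltac:(lia) ltac:(lia) isT isT isT.
rewrite /= c1 /inv_letter /=.
rewrite -!mulgA; congr (_ * _); rewrite mulgA c2 -!mulgA; congr (_ * _).
by rewrite mulgA c3 -!mulgA; congr (_ * _); rewrite mulgA (TK 2) mul1g.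
Qed.

(** Every distance from 2 to [k - 1] is a sum of twos and threes whose partial sums stay below
    [k]. *)
Lemma first_block_step1 : linked_step s 1.
Proof.
have sD := linked_stepD (s := s).
have big d : 1 < d < k -> linked_step s d.
  have [N] := ubnP d; elim: N d => // N IH d dN /andP[d1 dk].
  have [->|d2] := eqVneq d 2; first exact: step2.
  have [->|d3] := eqVneq d 3; first exact: step3.
  have -> : d = d - 2 + 2 by lia.
  by apply: sD; [rewrite modn_small; lia.. | apply: IH; lia | exact: step2].
(* Adding 3 to [k - 2] jumps over [k], where the points would coincide, and lands on 1 modulo
   [k]. *)
have s1 : linked_step s (k - 2 + 3).
  have e1 : (k - 2 + 3) %% k = 1%N.
    have -> : (k - 2 + 3 = 1 * k + 1)%N by lia.
    by rewrite modnMDl modn_small.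
  apply: sD; [by rewrite modn_small; lia.. | by rewrite e1 | apply: big; lia | exact: step3].
move=> u; have := s1 u; congr (linked _ _ _); apply: bpt_mod.
have -> : (u + (k - 2 + 3) = 1 * k + (u + 1))%N by lia.
by rewrite modnMDl.
Qed.

End FirstBlock.

End Block.
End Subgroup.

Section AllLinked.
Variables (n k : nat).
Hypothesis k_gt4 : 4 < k.
Hypothesis kn : k < n.
Let k_gt1 : 1 < k. Proof. by lia. Qed.

(** One point is held back, so that [n.-1] is fixed and can carry the sign. *)
Definition blocksA := n.-1 %/ k.
(** Starting at [k - 2] makes block [q] share exactly two points with block [q] of [cycA], and
    leaves 0 free for the sign. *)
Definition blocksB := (n - (k - 2)) %/ k.
Let n_gt0 : 0 < n. Proof. by lia. Qed.
Let nn : n.-1 < n. Proof. by lia. Qed.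
Let n1 : 1 < n. Proof. by lia. Qed.
Definition pt0 : 'I_n := Ordinal n_gt0.
Definition pt1 : 'I_n := Ordinal n1.
Definition ptmax : 'I_n := Ordinal nn.

Lemma A_fits : 0 + blocksA * k <= n.
Proof. by have := leq_trunc_div n.-1 k; rewrite /blocksA; lia. Qed.
Lemma A_out : ~~ ((0 <= ptmax) && (ptmax < 0 + blocksA * k)).
Proof. by have := leq_trunc_div n.-1 k; rewrite /blocksA /=; lia. Qed.
Lemma B_fits : k - 2 + blocksB * k <= n.
Proof. by have := leq_trunc_div (n - (k - 2)) k; rewrite /blocksB; lia. Qed.
Lemma B_out : ~~ ((k - 2 <= pt0) && (pt0 < k - 2 + blocksB * k)).
Proof. by rewrite /=; lia. Qed.
Lemma C_fits : n - k + 1 * k <= n.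
Proof. by lia. Qed.
Lemma C_out : ~~ ((n - k <= pt0) && (pt0 < n - k + 1 * k)).
Proof. by rewrite /=; lia. Qed.

Variables (eA eB eC : bool).
Definition cycA := cyc k 0 blocksA ptmax eA.
Definition cycB := cyc k (k - 2) blocksB pt0 eB.
Definition cycC := cyc k (n - k) 1 pt0 eC.
Definition cycF s := tr (pt0, s) (pt1, s) * cycA * tr (pt0, s) (pt1, ~~ s).

Variable H : fend n -> Prop.
Hypothesis H1 : H 1.
Hypothesis HM : forall f g, H f -> H g -> H (f * g).
Hypothesis HV : forall f g, H f -> f * g = 1 -> H g.
Hypothesis (HA : H cycA) (HB : H cycB) (HC : H cycC) (HF : forall s, H (cycF s)).
Hypothesis (Ak : cycA ^+ k = 1) (Bk : cycB ^+ k = 1) (Ck : cycC ^+ k = 1).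

(** The linked range grows from the first block of [cycA] through alternate blocks of [cycB] and
    [cycA]; the last [k] points come from [cycC]. *)
Lemma all_linked s i j : i != j -> linked H s i j.
Proof.
have blocksA_gt0 : 0 < blocksA by rewrite divn_gt0; lia.
have below_k : linked_below H s k.
  have E u : u < 2 -> bpt k 0 ptmax 0 u = u :> nat.
    by move=> u2; rewrite (val_bpt k_gt1 A_fits A_out blocksA_gt0) modn_small; lia.
  have s1 : linked_step H k 0 ptmax 0 s 1.
    apply: (first_block_step1 H1 HM HV k_gt1 A_fits A_out HA Ak blocksA_gt0 k_gt4).
    have -> : bpt k 0 ptmax 0 0 = pt0 by apply: val_inj; rewrite /= E.
    have -> : bpt k 0 ptmax 0 1 = pt1 by apply: val_inj; rewrite /= E.
    exact: HF.
  have st := linked_step1_all HM HV k_gt1 A_fits A_out blocksA_gt0 s1.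
  by move=> x y xk yk; apply: (linked_block k_gt1 A_fits A_out blocksA_gt0 st); rewrite mul0n; lia.
have blockA q h : q < blocksA -> (q * k).+1 < h -> h <= q * k + k ->
    linked_below H s h -> linked_below H s (q * k + k).
  move=> qm; have := linked_below_block H1 HM HV k_gt1 A_fits A_out HA Ak qm (s := s) (h := h).
  by rewrite add0n.
have blockB q h : q < blocksB -> (k - 2 + q * k).+1 < h -> h <= k - 2 + q * k + k ->
    linked_below H s h -> linked_below H s (k - 2 + q * k + k).
  by move=> qm; exact: (linked_below_block H1 HM HV k_gt1 B_fits B_out HB Bk qm).
have blockC h : (n - k).+1 < h -> h <= n ->
    linked_below H s h -> linked_below H s n.
  move=> h1 h2; have := linked_below_block H1 HM HV k_gt1 C_fits C_out HC Ck (ltn0Sn 0) (s := s) (h := h).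
  by rewrite mul0n addn0 subnK; [apply | exact: ltnW].
have qB q : q.+1 * k + (k - 2) <= n -> q < blocksB.
  by move=> h; rewrite /blocksB leq_divRL; lia.
(* From [q.+1 * k] a block of [cycB] reaches [q.+2 * k - 2], and the next block of [cycA] reaches
   [q.+2 * k]. *)
have below_q q : q < blocksA -> linked_below H s (q.+1 * k).
  elim: q => [|q IH] qm; first by rewrite mul1n.
  have hq : q.+2 * k <= n.-1 by rewrite -leq_divRL //; lia.
  rewrite !mulSn in hq.
  have l1 : linked_below H s (k - 2 + q * k + k).
    apply: (@blockB q (q.+1 * k)%N); [|rewrite mulSn; lia..|apply: IH; lia].
    by apply: qB; rewrite mulSn; lia.
  rewrite mulSn addnC; apply: blockA l1 => //; rewrite mulSn; lia.
have [m' hm] : exists m', blocksA = m'.+1 by exists blocksA.-1; rewrite prednK.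
have lA : linked_below H s (m'.+1 * k) by apply: below_q; rewrite hm.
have hn : n.-1 = m'.+1 * k + n.-1 %% k by rewrite -hm -divn_eq.
have hr : n.-1 %% k < k by rewrite ltn_mod; lia.
rewrite mulSn in lA hn.
suff ln : linked_below H s n by apply: ln.
(* A remainder of at least [k - 3] is exactly the case where one more block of [cycB] fits;
   otherwise [cycC] already overlaps the range in two points. *)
have [r_small|r_big] := ltnP (n.-1 %% k) (k - 3).
  by apply: blockC lA; lia.
have lB : linked_below H s (k - 2 + m' * k + k).
  by apply: blockB lA; [apply: qB; rewrite mulSn|..]; lia.
by apply: blockC lB; lia.
Qed.

Lemma all_tr a b : a.1 != b.1 -> H (tr a b).
Proof.
case: a b => i s [j t] /= ij; have h := all_linked s ij.
have [<-//|st] := eqVneq s t.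
have -> : t = ~~ s by case: s t st {h} => [] [].
exact: linkedV.
Qed.

End AllLinked.

(** * Elements of order k *)

Section Orders.
Variable n : nat.
Implicit Types (f g : fend n).

(* Exact order [k], visible already on the abelianization; such an [f] has order
   [k] in Aut, in Out and in SL. *)
Definition ab_order f k :=
  f ^+ k = 1 /\ forall j, 0 < j -> j < k -> abF (f ^+ j) <> 1%:M%R.

Lemma ab_order_conj f g h k : g * h = 1 -> h * g = 1 ->
  ab_order f k -> ab_order (g * f * h) k.
Proof.
move=> gh hg [fk fj].
have E t : (g * f * h) ^+ t = g * f ^+ t * h.
  elim: t => [|t IH]; first by rewrite !expg0 mulg1 gh.
  by rewrite expgS IH expgS !mulgA -(mulgA _ h g) hg mulg1.
split=> [|j j0 jk]; first by rewrite E fk mulg1 gh.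
rewrite E => e; apply: (fj j j0 jk).
have -> : f ^+ j = h * (g * f ^+ j * h) * g.
  by rewrite !mulgA hg mul1g -mulgA hg mulg1.
by rewrite abFM abFM e mul1mx -abFM hg abF1.
Qed.

Lemma det_abFX f t : (\det (abF (f ^+ t)%g) = (\det (abF f)) ^+ t)%R.
Proof.
elim: t => [|t IH]; first by rewrite expg0 abF1 det1.
by rewrite expgS abFM det_mulmx IH exprSr.
Qed.

Lemma autp_of_order f k : 0 < k -> f ^+ k = 1 -> (\det (abF f) = 1)%R -> autp f.
Proof.
move=> k0 fk df; split=> //; exists (f ^+ k.-1).
by rewrite -expgS -expgSr prednK.
Qed.

Variables (k a m : nat) (p : 'I_n).
Hypothesis k_gt1 : 1 < k.
Hypothesis amn : a + m * k <= n.
Hypothesis p_out : ~~ ((a <= p) && (p < a + m * k)).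
Let k_gt0 : 0 < k. Proof. exact: ltnW. Qed.

Lemma cyc_flip : cyc k a m p true = cyc k a m p false * flip p.
Proof.
apply/ffunP => i; rewrite [LHS]ffunE [RHS]ffunE ffunE ext_gl ev_cyc //.
by rewrite /rot_letter /= addbF.
Qed.

(* A product of [k]-cycles is odd only for even [k]; then flipping the sign of a
   fixed generator restores determinant one without changing the order. *)
Definition odd_cyc := (\det (abF (cyc k a m p false)) != 1)%R.
Definition scyc := cyc k a m p odd_cyc.

(** The determinant is an integer whose [k]-th power is 1, hence 1 or -1, and -1 forces [k] to be
    even. *)
Lemma scyc_spec : scyc ^+ k = 1 /\ (\det (abF scyc) = 1)%R.
Proof.
have dk : ((\det (abF (cyc k a m p false))) ^+ k = 1)%R.
  by rewrite -det_abFX cycXk // abF1 det1.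
have dpm : (\det (abF (cyc k a m p false)) = 1 \/
            \det (abF (cyc k a m p false)) = -1)%R.
  move: dk; rewrite -(prednK k_gt0) exprS => /(congr1 absz)/eqP.
  by rewrite abszM muln_eq1 => /andP[/eqP h _]; lia.
rewrite /scyc; split.
  apply: cycXk => //; rewrite /odd_cyc; case: dpm => e; first by rewrite e eqxx.
  by move=> _; apply/negP => ok; move: dk; rewrite e -signr_odd ok.
rewrite /odd_cyc; case: dpm => e; rewrite e ?eqxx //=.
by rewrite cyc_flip abFM det_mulmx det_flip e.
Qed.

Lemma scyc_autp : autp scyc.
Proof. by have [h1 h2] := scyc_spec; apply: autp_of_order h1 h2. Qed.

Hypothesis m_gt0 : 0 < m.

(** For [0 < j < k] the diagonal entry of the [j]-th power at the first point of a block is 0. *)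
Lemma scyc_order : ab_order scyc k.
Proof.
have [h1 _] := scyc_spec; split=> // j j0 jk.
have E u : val (bpt k a p 0 u) = a + 0 * k + u %% k by exact: (val_bpt k_gt1 amn p_out m_gt0 u).
move/matrixP/(_ (bpt k a p 0 0) (bpt k a p 0 0)); rewrite !mxE eqxx.
have := ev_cycX k_gt0 odd_cyc amn p_out j (bpt k a p 0 0, true).
rewrite -/scyc /ev /= => ->.
rewrite expsum_gl /rot_letter /= (orot_bpt k_gt1 amn p_out m_gt0).
by rewrite -val_eqE !E mod0n add0n modn_small // addn0 -[X in _ == X]addn0 eqn_add2l (gtn_eqF j0).
Qed.

End Orders.

Lemma In_mem (T : eqType) (x : T) (s : seq T) : List.In x s <-> x \in s.
Proof.
elim: s => //= y s IH; rewrite inE; split.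
  by case=> [->|/IH ->]; rewrite ?eqxx ?orbT.
by case/orP => [/eqP ->|/IH]; [left|right].
Qed.

(** * The five generators and the three groups *)

Section Generation.
Variables (n k : nat).
Hypothesis k_gt4 : 4 < k.
Hypothesis hn : 2 * (k - 1) <= n.
Let kn : k < n. Proof. by lia. Qed.
Let k_gt1 : 1 < k. Proof. by lia. Qed.
Let k_gt0 : 0 < k. Proof. by lia. Qed.
Local Notation blocksA := (blocksA n k).
Local Notation blocksB := (blocksB n k).
Local Notation pt0 := (pt0 k_gt4 kn).
Local Notation pt1 := (pt1 k_gt4 kn).
Local Notation ptmax := (ptmax k_gt4 kn).
Local Open Scope group_scope.

Definition genA := scyc k 0 blocksA ptmax.
Definition genB := scyc k (k - 2) blocksB pt0.
Definition genC := scyc k (n - k) 1 pt0.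
Definition genF (s : bool) := tr (pt0, s) (pt1, s) * genA * tr (pt0, s) (pt1, ~~ s).
Definition gens : seq (fend n) := [:: genA; genB; genC; genF true; genF false].

Let blocksA_gt0 : 0 < blocksA. Proof. by rewrite divn_gt0; lia. Qed.
(** The bound [2 * (k - 1) <= n] says exactly that a block of length [k] fits after the first
    [k - 2] points. *)
Let blocksB_gt0 : 0 < blocksB. Proof. by rewrite divn_gt0; lia. Qed.
Let n_gt2 : 2 < n. Proof. by lia. Qed.

Let AP := scyc_spec k_gt1 (A_fits k_gt4 kn) (A_out k_gt4 kn).
Let BP := scyc_spec k_gt1 (B_fits k_gt4 kn) (B_out k_gt4 kn).
Let CP := scyc_spec k_gt1 (C_fits k_gt4 kn) (C_out k_gt4 kn).

Let trF s : tr (pt0, s) (pt1, s) * tr (pt0, s) (pt1, ~~ s) = 1.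
Proof. by rewrite -[(pt1, ~~ s)]/(inv_letter (pt1, s)) trK. Qed.
Let trFV s : tr (pt0, s) (pt1, ~~ s) * tr (pt0, s) (pt1, s) = 1.
Proof. by rewrite -[(pt1, ~~ s)]/(inv_letter (pt1, s)) trVK. Qed.

Let genF_spec s : autp (genF s) /\ ab_order (genF s) k.
Proof.
have oF : ab_order (genF s) k.
  apply: (ab_order_conj (trF s) (trFV s)).
  exact: scyc_order k_gt1 (A_fits k_gt4 kn) (A_out k_gt4 kn) blocksA_gt0.
split=> //; apply: (autp_of_order k_gt0); first by have [] := oF.
by rewrite !abFM !det_mulmx !det_abF_tr // mul1r mulr1; have [_ ->] := AP.
Qed.

Lemma gens_spec g : g \in gens -> autp g /\ ab_order g k.
Proof.
rewrite !inE => /or4P[/eqP->|/eqP->|/eqP->|/orP[]/eqP->]; try exact: genF_spec.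
- split; first exact: scyc_autp k_gt1 (A_fits k_gt4 kn) (A_out k_gt4 kn).
  exact: scyc_order k_gt1 (A_fits k_gt4 kn) (A_out k_gt4 kn) blocksA_gt0.
- split; first exact: scyc_autp k_gt1 (B_fits k_gt4 kn) (B_out k_gt4 kn).
  exact: scyc_order k_gt1 (B_fits k_gt4 kn) (B_out k_gt4 kn) blocksB_gt0.
- split; first exact: scyc_autp k_gt1 (C_fits k_gt4 kn) (C_out k_gt4 kn).
  exact: scyc_order k_gt1 (C_fits k_gt4 kn) (C_out k_gt4 kn) (ltn0Sn 0).
Qed.

(** Positive words are enough, because [y ^+ k.-1] is the inverse of a generator [y]. *)
Definition generated f := exists2 ys, {subset ys <= gens} & f = \prod_(y <- ys) y.

Let generated1 : generated 1.
Proof. by exists [::]; rewrite ?big_nil. Qed.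

Let generatedM f g : generated f -> generated g -> generated (f * g).
Proof.
move=> [ys hy ->] [zs hz ->]; exists (ys ++ zs); last by rewrite big_cat.
by move=> y; rewrite mem_cat => /orP[/hy|/hz].
Qed.

Let generated_gen g : g \in gens -> generated g.
Proof.
by move=> hg; exists [:: g]; rewrite ?big_seq1 // => y; rewrite inE => /eqP ->.
Qed.

Let generatedX f t : generated f -> generated (f ^+ t).
Proof. by move=> h; elim: t => [|t IH]; rewrite ?expg0 // expgS; apply: generatedM. Qed.

Let generatedV f g : generated f -> f * g = 1 -> generated g.
Proof.
move=> [ys hy ->] {f}.
suff [h hh hP] : exists2 h, generated h & h * \prod_(y <- ys) y = 1.
  by move=> e; rewrite -[g]mul1g -hP -mulgA e mulg1.
elim: ys hy => [|y ys IH] hy; first by exists 1; rewrite ?big_nil ?mulg1.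
have [|h hh hP] := IH; first by move=> x xy; apply: hy; rewrite inE xy orbT.
have yg : y \in gens by apply: hy; rewrite inE eqxx.
exists (h * y ^+ k.-1); first by apply: generatedM => //; apply: generatedX; apply: generated_gen.
have [_ [yk _]] := gens_spec yg.
by rewrite big_cons mulgA -(mulgA h) -expgSr prednK // yk mulg1.
Qed.

Lemma generated_tr a b : a.1 != b.1 -> generated (tr a b).
Proof.
apply: (@all_tr n k k_gt4 kn (odd_cyc k 0 blocksA ptmax) (odd_cyc k (k - 2) blocksB pt0)
  (odd_cyc k (n - k) 1 pt0) generated generated1 generatedM generatedV).
- by apply: generated_gen; rewrite !inE eqxx.
- by apply: generated_gen; rewrite !inE eqxx orbT.
- by apply: generated_gen; rewrite !inE eqxx !orbT.
- by case; apply: generated_gen; rewrite !inE eqxx !orbT.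
- by have [] := AP.
- by have [] := BP.
- by have [] := CP.
Qed.

Lemma generated_autp f : autp f -> generated f.
Proof. exact: nielsen n_gt2 generated generated1 generatedM generated_tr f. Qed.

Lemma unred_gens (s : endo n) : List.In s (map (@unred n) gens) -> red s \in gens.
Proof. by move/In_mem => /mapP[g hg ->]; rewrite unredK. Qed.

Lemma generates_unred (f : endo n) : is_autplus f ->
  exists ys : seq (endo n),
    (forall y, List.In y ys -> List.In y (map (@unred n) gens)) /\
    endo_eq f (foldr (@endo_comp n) (endo_id n) ys).
Proof.
move=> /is_autplusP/generated_autp[ys hy e]; exists (map (@unred n) ys); split.
  by move=> y /In_mem/mapP[g /hy hg ->]; apply/In_mem/map_f.
apply/redP; rewrite e; elim: ys {hy e} => [|y ys IH]; first by rewrite big_nil red1.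
by rewrite big_cons /= redM unredK IH.
Qed.

Lemma red_iter (f : endo n) t : red (iter t (endo_comp f) (endo_id n)) = red f ^+ t.
Proof. by elim: t => [|t IH]; rewrite ?red1 //= redM IH expgS. Qed.

Lemma dk_AutPlus : dk_le (AutPlus n) k 5.
Proof.
exists (map (@unred n) gens); split; first by [].
split=> [s /unred_gens/gens_spec[sa [sk sj]]|f /generates_unred[ys [hy e]]].
  split; first exact/is_autplusP.
  split; first exact: k_gt0.
  split; first by apply/redP; rewrite /cg_pow red_iter sk red1.
  move=> j j0 jk /redP; rewrite /cg_pow red_iter red1 => e.
  by apply: (sj j j0 jk); rewrite e abF1.
by exists ys; split=> // y /hy; left.
Qed.

(** Conjugation is invisible to exponent sums, so powers that are nontrivial on the abelianization
    stay nontrivial in Out. *)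
Lemma out_eq_abmx (f g : endo n) : out_eq f g -> abmx f = abmx g.
Proof.
move=> [w e]; apply/matrixP => i j; rewrite !mxE -expsum_reduce e expsum_reduce.
have := expsum_cat j w (winv w).
rewrite -expsum_reduce -[reduce _]/(fw (ofw _)) ofw_cat ofw_winv mulgV expsum1.
by rewrite !expsum_cat => /esym h; rewrite addrCA h addr0.
Qed.

Lemma endo_eq_out (f g : endo n) : endo_eq f g -> out_eq f g.
Proof. by move=> e; exists [::] => i; rewrite /= cats0. Qed.

Lemma dk_OutPlus : dk_le (OutPlus n) k 5.
Proof.
exists (map (@unred n) gens); split; first by [].
split=> [s /unred_gens/gens_spec[sa [sk sj]]|f /generates_unred[ys [hy e]]].
  split; first exact/is_autplusP.
  split; first exact: k_gt0.
  split; first by apply/endo_eq_out/redP; rewrite /cg_pow red_iter sk red1.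
  move=> j j0 jk /out_eq_abmx; rewrite /cg_pow !abmx_red red_iter red1 abF1.
  exact: sj.
by exists ys; split; [move=> y /hy; left | exact: endo_eq_out].
Qed.

Lemma abF_iter (f : fend n) t : iter t (mulmx (abF f)) 1%:M%R = abF (f ^+ t).
Proof.
elim: t => [|t IH]; first by rewrite expg0 abF1.
by rewrite /= IH expgSr abFM.
Qed.

Lemma dk_SLZ : dk_le (SLZ n) k 5.
Proof.
exists (map (@abF n) gens); split; first by [].
split=> [s /In_mem/mapP[g /gens_spec[[_ dg] [gk gj]] ->]|A dA].
  split; first exact: dg.
  split; first exact: k_gt0.
  rewrite /cg_pow /=; split; first by rewrite abF_iter gk abF1.
  by move=> j j0 jk; rewrite abF_iter; exact: gj.
pose K (B : 'M[int]_n) := exists2 f, generated f & B = abF f.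
have [f [ys hy ->] ->] : K A.
  apply: (sl_generated n_gt2) dA => [|B C [f hf ->] [g hg ->]|a b ab].
  - by exists 1; rewrite ?abF1.
  - by exists (g * f); [exact: generatedM | rewrite abFM].
  - by exists (tr a b) => //; exact: generated_tr.
(* The word is reversed because [abF] reverses products. *)
exists (rev (map (@abF n) ys)); split.
  move=> y /In_mem; rewrite mem_rev => /mapP[g /hy hg ->]; left.
  exact/In_mem/map_f.
elim: ys {hy} => [|y ys IH]; first by rewrite big_nil abF1.
rewrite big_cons abFM IH /= rev_cons -cats1 foldr_cat /= mulmx1.
elim: (rev _) {IH} => [|B Bs IH] /=; first by rewrite mul1mx.
by rewrite -mulmxA IH.
Qed.

End Generation.

Lemma dk_le_weaken (G : cgroup) k m m' : m <= m' -> dk_le G k m -> dk_le G k m'.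
Proof. by move=> mm' [S [hS h]]; exists S; split=> //; apply: leq_trans mm'. Qed.

Local Close Scope group_scope.

Theorem theorem1p2 (n k : nat) (G : cgroup) :
  5 <= k -> 2 * (k - 1) <= n ->
  (G = AutPlus n \/ G = OutPlus n \/ G = SLZ n) ->
  dk_le G k 6 /\ (6 <= k -> 2 * k <= n -> dk_le G k 5).
Proof.
(* The same five elements give both bounds; 6 follows from 5 by weakening. *)
move=> k5 hn hG; suff h5 : dk_le G k 5 by split=> // ; apply: dk_le_weaken h5.
case: hG => [->|[->|->]]; [exact: dk_AutPlus | exact: dk_OutPlus | exact: dk_SLZ].
Qed.
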